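(* Suppose a target is hidden on a tree network $Q$ of total length $\mu$ according to the uniform distribution $u$. Then (i) for any root $O$, $u$ is strongly simply searchable and the minimum expected search time is $V(u)=\mu-\bar d(O)$; and (ii) the choice of root $O\in Q$ that minimizes the expected search time of any depth-first search is the leaf node $x$ that maximizes $\bar d(x)$.
   Context: $Q$ is a (finite) tree network: each arc $a$ is a segment of length $\lambda(a)>0$, and points of $Q$ may be nodes or interior points of arcs. $\lambda$ denotes the induced length measure on $Q$, $\mu=\lambda(Q)$, $d$ is the path-length metric, and $P(x,y)$ is the path from $x$ to $y$. A point $O\in Q$ is designated the root (starting point). The uniform distribution is $u(A)=\lambda(A)/\mu$ for measurable $A\subset Q$, and $\bar d(x)=\int_{y\in Q}d(x,y)\,du(y)$. A search with root $O$ is a function $S:[0,\infty)\to Q$ with $S(0)=O$ and $d(S(t_1),S(t_2))\le t_2-t_1$ for $0\le t_1<t_2$; the behaviour of $S$ after all of $Q$ has been covered is irrelevant (disregarded). Put $T(S,x)=\min\{t\ge 0:S(t)=x\}$ (or $+\infty$) and, for a Borel probability measure $h$ on $Q$ (hiding distribution), $T(S,h)=\int_Q T(S,x)\,dh(x)$. A search is optimal if it minimizes $T(S,h)$ over all searches, and $V(h)$ is the minimum value. All searches considered are assumed normal: whenever $t_1<t_2$ and $S([t_1,t_2])=P(S(t_1),S(t_2))$, then for $0\le s\le t_2-t_1$, $S(t_1+s)$ is the point of $P(S(t_1),S(t_2))$ at distance $s$ from $S(t_1)$. A depth-first (DF) search is a sequence of arcs traversed at unit speed, starting and ending at $O$,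 such that when leaving a node the unique arc towards the root is chosen only if all the other arcs at the node have been traversed (so each arc is traversed exactly once in each direction). $h$ is strongly simply searchable if the only optimal searches are DF. In (ii), a leaf node is a node of degree 1 of $Q$. *)

(* Defs.v *)
From HB Require Import structures.
From mathcomp Require Import all_boot all_order all_algebra.
From mathcomp Require Import all_classical all_reals all_analysis.
From mathcomp Require Import measurable_realfun lra.

Set Implicit Arguments.
Unset Strict Implicit.
Unset Printing Implicit Defensive.
Import Order.TTheory GRing.Theory Num.Theory.
Import numFieldNormedType.Exports.

Local Open Scope classical_set_scope.
Local Open Scope ring_scope.

(* The orientation [asrc a -> atgt a] of an arc only serves to coordinatize
   it by [0, len a]; arcs can be travelled in both directions. *)
Record network (R : realType) := Network {
  node : finType;
  arc : finType;
  asrc : arc -> node;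
  atgt : arc -> node;
  len : arc -> R;
  len_gt0 : forall a, 0 < len a }.

Section walks.
Context {R : realType} (Q : network R).

(* A dart is an arc with a direction of travel ([true]: from asrc to atgt). *)
Definition dart_from (e : arc Q * bool) := if e.2 then asrc e.1 else atgt e.1.
Definition dart_to (e : arc Q * bool) := if e.2 then atgt e.1 else asrc e.1.

Fixpoint walk (x : node Q) (w : seq (arc Q * bool)) (y : node Q) : bool :=
  if w is e :: w' then (dart_from e == x) && walk (dart_to e) w' y
  else x == y.

Definition simple_walk x w y := walk x w y && uniq (x :: map dart_to w).

Definition incident (a : arc Q) (v : node Q) := (asrc a == v) || (atgt a == v).

Definition degree (v : node Q) := #|[set a | incident a v]%SET|.

Definition leaf_node (v : node Q) := degree v = 1%N.

Definition total_length : R := \sum_(a : arc Q) len a.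
End walks.

(* A one-point network carries no uniform distribution, hence
   [arc_nonempty]. *)
Record tree_network (R : realType) := TreeNetwork {
  tree_net :> network R;
  arc_nonempty : (0 < #|arc tree_net|)%N;
  no_loop : forall a : arc tree_net, asrc a != atgt a;
  unique_path : forall x y : node tree_net, exists! w, simple_walk x w y }.

Section points.
Context {R : realType} (Q : tree_network R).

Definition node_path (x y : node Q) : seq (arc Q * bool) :=
  sval (cid (unique_path x y)).

Definition node_dist (x y : node Q) : R :=
  \sum_(e <- node_path x y) len e.1.

Definition tree_point : Type :=
  (node Q + {p : arc Q * R | (0 < p.2) && (p.2 < len p.1)})%type.

Definition Node (v : node Q) : tree_point := inl v.

(* The parametrization of arc [a] by [0, len a], constant outside. *)
Definition arc_point (a : arc Q) (s : R) : tree_point :=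
  if insub (a, s) is Some p then inr p
  else Node (if s <= 0 then asrc a else atgt a).

Definition node_point_dist (v : node Q) (y : tree_point) : R :=
  match y with
  | inl w => node_dist v w
  | inr q => let: (a, s) := val q in
      Num.min (node_dist v (asrc a) + s) (node_dist v (atgt a) + (len a - s))
  end.

(* The only path between two points of the same arc stays in that arc; any
   other path issued from an interior point of an arc goes through one of the
   two ends of the arc, namely the one giving the minimum. *)
Definition dist (x y : tree_point) : R :=
  match x with
  | inl v => node_point_dist v y
  | inr p => let: (a, s) := val p in
      let through_end := Num.min (s + node_point_dist (asrc a) y)
                                 (len a - s + node_point_dist (atgt a) y) in
      if y is inr q then
        if (val q).1 == a then `|s - (val q).2| else through_end
      else through_end
  end.

(* In a tree, the path from x to y consists of the points z for which going
   from x to y through z is no detour. *)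
Definition tree_path (x y : tree_point) : set tree_point :=
  [set z | dist x z + dist z y = dist x y].

HB.instance Definition _ := Choice.on tree_point.

Let point0 : tree_point :=
  Node (asrc (@enum_val _ predT (Ordinal (arc_nonempty Q)))).
HB.instance Definition _ := isPointed.Build tree_point point0.

Definition dist_open : set (set tree_point) :=
  [set U | forall x, U x ->
     exists2 r : R, 0 < r & forall y, dist x y < r -> U y].

(* The Borel sigma-algebra of the metric [dist]. *)
HB.instance Definition _ :=
  Measurable.copy tree_point (g_sigma_algebraType dist_open).
End points.

Section length_measure.
Context {R : realType} (Q : tree_network R).
Implicit Types (a : arc Q).

Lemma node_pathE (x y : node Q) w : simple_walk x w y -> node_path x y = w.
Proof.
rewrite /node_path; case: cid => w' /= [_ uw] hw; exact: uw.
Qed.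

Lemma node_dist0 (x : node Q) : node_dist x x = 0.
Proof.
rewrite /node_dist (@node_pathE _ _ [::]) ?big_nil//.
by rewrite /simple_walk /= eqxx.
Qed.

Lemma node_dist_arc a :
  node_dist (asrc a) (atgt a) = len a /\ node_dist (atgt a) (asrc a) = len a.
Proof.
rewrite /node_dist (@node_pathE _ _ [:: (a, true)]); last first.
  by rewrite /simple_walk /= !eqxx inE no_loop.
rewrite (@node_pathE _ _ [:: (a, false)]) ?big_seq1//.
by rewrite /simple_walk /= !eqxx inE eq_sym no_loop.
Qed.

Lemma dist_arc_point a (s t : R) :
  dist (arc_point a s) (arc_point a t) <= `|s - t|.
Proof.
have la := len_gt0 a; have [d1 d2] := node_dist_arc a.
have le_norm (x : R) : x <= `|x| /\ - x <= `|x|.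
  by split; [exact: ler_norm|rewrite -normrN ler_norm].
have [n1 n2] := le_norm (s - t).
rewrite /arc_point; case: insubP => [p|] /= hs; last first.
  case: insubP => [q|] /= ht.
    move=> qE; rewrite qE; case: ifPn => h0.
      by rewrite ge_min node_dist0; apply/orP; left; lra.
    rewrite ge_min node_dist0; apply/orP; right.
    by move: hs ht; rewrite -ltNge in h0; rewrite h0 /= -leNgt; lra.
  case: ifPn => h0; case: ifPn => h1; rewrite ?node_dist0 ?normr_ge0//.
    by move: ht; rewrite -ltNge in h1; rewrite h1 /= -leNgt d1; lra.
  by move: hs; rewrite -ltNge in h0; rewrite h0 /= -leNgt d2; lra.
move=> pE; rewrite pE; case: insubP => [q|] /= ht.
  by move=> ->; rewrite eqxx.
case: ifPn => h0.
  by rewrite ge_min node_dist0; apply/orP; left; lra.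
rewrite ge_min node_dist0; apply/orP; right.
by move: hs ht; rewrite -ltNge in h0; rewrite h0 /= -leNgt; lra.
Qed.

Lemma measurable_arc_point a :
  measurable_fun [set: R] (arc_point a : R -> tree_point Q).
Proof.
apply: (measurability (@dist_open R Q)) => //.
move=> _ [U oU <-]; rewrite setTI.
apply: open_measurable; rewrite openE => s /= Us.
have [r r0 hr] := oU _ Us.
apply/nbhs_ballP; exists r => //= t; rewrite /ball /= => st.
by apply: hr; apply: le_lt_trans st; exact: dist_arc_point.
Qed.

Definition arc_measure a : set (tree_point Q) -> \bar R :=
  pushforward (mrestr (@lebesgue_measure R) (measurable_itv `]0, len a[))
              (arc_point a).

Lemma arc_measure0 a : arc_measure a set0 = 0%E.
Proof. by rewrite /arc_measure /pushforward preimage_set0 measure0. Qed.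

Lemma arc_measure_ge0 a A : (0 <= arc_measure a A)%E.
Proof. by rewrite /arc_measure /pushforward measure_ge0. Qed.

Lemma arc_measure_sigma_additive a : semi_sigma_additive (arc_measure a).
Proof.
move=> F mF tF mUF; rewrite /arc_measure /pushforward preimage_bigcup.
apply: measure_semi_sigma_additive.
- by move=> n; rewrite -[X in measurable X]setTI; exact: measurable_arc_point.
- apply/trivIsetP => /= i j _ _ ij; rewrite -preimage_setI.
  by move/trivIsetP : tF => /(_ _ _ _ _ ij) ->//; rewrite preimage_set0.
- rewrite -preimage_bigcup -[X in measurable X]setTI.
  exact: measurable_arc_point.
Qed.

HB.instance Definition _ a := isMeasure.Build _ _ _ (arc_measure a)
  (arc_measure0 a) (arc_measure_ge0 a) (@arc_measure_sigma_additive a).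

Definition length_measure (A : set (tree_point Q)) : \bar R :=
  (\sum_(a : arc Q) arc_measure a A)%E.

Let length_measure0 : length_measure set0 = 0%E.
Proof. by rewrite /length_measure big1// => a _; rewrite measure0. Qed.

Let length_measure_ge0 A : (0 <= length_measure A)%E.
Proof. by apply: sume_ge0 => a _; exact: measure_ge0. Qed.

Let length_measure_sigma_additive : semi_sigma_additive length_measure.
Proof.
move=> F mF tF mUF; rewrite [X in _ --> X](_ : _ =
    limn (fun n => \sum_(0 <= i < n) length_measure (F i))%E).
  by apply: is_cvg_nneseries => i _ _; exact: length_measure_ge0.
rewrite /length_measure nneseries_sum//.
by apply: eq_bigr => a _; exact: measure_semi_bigcup.
Qed.

HB.instance Definition _ := isMeasure.Build _ _ _ length_measure
  length_measure0 length_measure_ge0 length_measure_sigma_additive.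

Lemma length_measureT : length_measure setT = (total_length Q)%:E.
Proof.
rewrite /length_measure /total_length -sumEFin; apply: eq_bigr => a _.
rewrite /arc_measure /pushforward /mrestr preimage_setT setTI.
by rewrite lebesgue_measure_itv/= lte_fin len_gt0 sube0.
Qed.

Lemma total_length_gt0 : 0 < total_length Q.
Proof.
rewrite /total_length (bigD1 (enum_val (Ordinal (arc_nonempty Q))))//=.
by rewrite ltr_pwDl ?len_gt0// sumr_ge0// => a _; rewrite ltW// len_gt0.
Qed.

Lemma inv_total_length_ge0 : 0 <= (total_length Q)^-1.
Proof. by rewrite invr_ge0 ltW// total_length_gt0. Qed.

Definition uniform_law : set (tree_point Q) -> \bar R :=
  mscale (NngNum inv_total_length_ge0) length_measure.

HB.instance Definition _ := Measure.on uniform_law.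

Let uniform_lawT : uniform_law setT = 1%E.
Proof.
rewrite /uniform_law /mscale /= length_measureT -EFinM mulVf//.
by rewrite gt_eqF// total_length_gt0.
Qed.

HB.instance Definition _ := Measure_isProbability.Build _ _ _ uniform_law
  uniform_lawT.

End length_measure.
Arguments uniform_law {R} Q A.

Section search.
Context {R : realType} (Q : tree_network R).
Implicit Types (O x : tree_point Q) (S : R -> tree_point Q).
Implicit Types (h : probability (tree_point Q) R).

(* Searches are total functions on R, of which only the values at times
   [t >= 0] matter. For continuous S the infimum defining the first visit
   to x is attained if S visits x, and it is +oo otherwise. *)
Definition search_time S x : \bar R :=
  ereal_inf [set t%:E | t in [set t : R | 0 <= t /\ S t = x]].

Definition expected_time S h : \bar R := (\int[h]_x search_time S x)%E.

Definition cover_time S : \bar R :=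
  ereal_inf [set t%:E | t in
    [set t : R | 0 <= t /\ forall x, exists2 s, 0 <= s <= t & S s = x]].

(* The restriction to times before [cover_time S] expresses that the
   behaviour of [S] once Q has been covered is disregarded. *)
Definition normal S := forall t1 t2 : R, 0 <= t1 -> t1 < t2 ->
  (t2%:E <= cover_time S)%E ->
  S @` `[t1, t2] = tree_path (S t1) (S t2) ->
  forall s, 0 <= s <= t2 - t1 ->
    tree_path (S t1) (S t2) (S (t1 + s)) /\ dist (S t1) (S (t1 + s)) = s.

Definition search O S :=
  [/\ S 0 = O,
      forall t1 t2 : R, 0 <= t1 -> t1 < t2 -> dist (S t1) (S t2) <= t2 - t1
    & normal S].

Definition optimal O h S :=
  search O S /\
  forall S', search O S' -> (expected_time S h <= expected_time S' h)%E.

Definition min_time O h : \bar R :=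
  ereal_inf [set expected_time S h | S in search O].

(* A leg [(a, s, t)] is a straight move along arc [a], from the point of
   coordinate [s] to the point of coordinate [t]. *)
Definition leg : Type := (arc Q * R * R)%type.
Implicit Types (l : leg) (w : seq leg).

Definition leg_start l : tree_point Q := arc_point l.1.1 l.1.2.
Definition leg_end l : tree_point Q := arc_point l.1.1 l.2.
Definition leg_len l : R := `|l.2 - l.1.2|.
Definition leg_rev l : leg := (l.1.1, l.2, l.1.2).
Definition leg_at l (s : R) : tree_point Q :=
  arc_point l.1.1 (l.1.2 + Num.sg (l.2 - l.1.2) * s).

(* A root interior to an arc is considered a node: it splits its arc in
   two. *)
Definition rooted_arcs O : seq leg :=
  match O with
  | inl _ => [seq (a, 0, len a) | a <- enum (arc Q)]
  | inr p => let: (a0, s0) := val p in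
      [:: (a0, 0, s0), (a0, s0, len a0)
        & [seq (a, 0, len a) | a <- enum (arc Q) & a != a0]]
  end.

Definition rooted_legs O : seq leg :=
  rooted_arcs O ++ map leg_rev (rooted_arcs O).

Fixpoint leg_walk x w (y : tree_point Q) : bool :=
  if w is l :: w' then (leg_start l == x) && leg_walk (leg_end l) w' y
  else x == y.

Definition towards_root O l := dist O (leg_end l) < dist O (leg_start l).

(* A leg not towards the root and starting where [l] starts belongs to an arc
   that has been completely dealt with as soon as it occurs in [w1], since the
   walk has to come back through that arc before leaving by [l]. *)
Definition df_tour O w :=
  [/\ leg_walk O w O,
      perm_eq w (rooted_legs O)
    & forall w1 l w2, w = w1 ++ l :: w2 -> towards_root O l ->
      forall l', l' \in rooted_legs O -> leg_start l' = leg_start l ->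
        l' != l -> l' \in w1].

Definition unit_speed S w := forall w1 l w2, w = w1 ++ l :: w2 ->
  forall s, 0 <= s <= leg_len l ->
    S (\sum_(k <- w1) leg_len k + s) = leg_at l s.

Definition depth_first O S :=
  search O S /\ exists2 w, df_tour O w & unit_speed S w.

(* Being depth-first is meant up to the behaviour after Q is covered. *)
Definition strongly_simply_searchable O h := forall S, optimal O h S ->
  exists2 S', depth_first O S' &
    forall t, 0 <= t -> (t%:E <= cover_time S)%E -> S t = S' t.

Definition mean_dist x : \bar R :=
  (\int[uniform_law Q]_y (dist x y)%:E)%E.

End search.

(* Main.v *)
From mathcomp Require Import all_boot all_order all_algebra.
From mathcomp Require Import all_classical all_reals all_analysis.
From mathcomp Require Import measurable_realfun ring lra zify.
Require Import Defs.

Set Implicit Arguments.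
Unset Strict Implicit.
Unset Printing Implicit Defensive.
Import Order.TTheory GRing.Theory Num.Theory.
Import numFieldNormedType.Exports.
Local Open Scope ring_scope.

(** The projections on the arcs embed the tree isometrically into l^1
    ([distE]), so that a search is a family of real functions, one for each arc,
    the total variation of which grows at most at unit speed. Cut each arc at
    the projection of the root [O] into arms oriented away from the root, and
    let the reach of an arm be the largest coordinate attained on it. A real
    function that starts from 0, has maximum [m] and ends at [c] has variation
    at least [2 m - c]. Summing over the arms, for every search [S],

      [t + dist O (S t) >= 2 * (length visited up to time t)],

    and the difference, called slack here, never decreases ([slack_climb]).

    Lower bound. Take for [t] the time [T x] when [x] is discovered, so that
    [S t = x]: then [T x + dist O x] is at least twice the length of the set of
    points discovered no later than [x]. Now average over a uniform [x]. Of two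
    independent points each is equally likely to come first, so the mean of the
    right-hand side is at least the total length, and the mean search time is at
    least the total length minus the mean distance to the root
    ([expected_time_ge]).

    Depth-first searches have no slack, because on a walk that uses each leg at
    most once the time plus the depth is twice the length of the outward legs
    used ([leg_walk_len]); hence they attain the bound
    ([depth_first_expected_time]). They exist because a depth-first walk can
    be prolonged until it is a tour: a walk that is stuck is at the root, by
    counting arrivals and departures, and has then used everything
    ([partial_tour_extend]). They are normal for lack of slack
    ([no_slack_normal]).

    Conversely, an optimal search has no slack as long as some point is not
    visited ([optimal_no_slack]), and then the coordinate on each arm, once
    below its maximum, only decreases ([no_climb]). As every arm must be explored
    to its end, the search can neither turn back inside an arm nor leave the far
    end of an arm before all that is beyond is explored: until everything is
    visited it performs a depth-first walk at unit speed ([follow_tour]).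

    For the choice of the root it remains to maximize the mean distance. It is
    strictly convex along an arc, and along two consecutive arcs at a node, so
    its maximum over the tree is attained at leaf nodes only
    ([mean_dist_max]). *)

(** * Paths between nodes *)

Section NodePaths.
Context {R : realType} (Q : tree_network R).
Implicit Types (a b : arc Q) (e : arc Q * bool) (x y v : node Q).
Implicit Types (w : seq (arc Q * bool)).

Definition flip e : arc Q * bool := (e.1, ~~ e.2).

Lemma dart_from_flip e : dart_from (flip e) = dart_to e.
Proof. by case: e => a []. Qed.

Lemma dart_to_flip e : dart_to (flip e) = dart_from e.
Proof. by case: e => a []. Qed.

Lemma flipK : involutive flip.
Proof. by case=> a b; rewrite /flip /= negbK. Qed.

Lemma dart_neq e : dart_from e != dart_to e.
Proof.
case: e => a []; rewrite /dart_from /dart_to /= ?(eq_sym (atgt a));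
  exact: no_loop.
Qed.

Lemma walk_last x w y : walk x w y -> last x (map (@dart_to R Q) w) = y.
Proof. by elim: w x => [|e w IH] x /=; [move/eqP|case/andP => _ /IH]. Qed.

Lemma walk_cat x w1 w2 y : walk x (w1 ++ w2) y =
  walk x w1 (last x (map (@dart_to R Q) w1))
  && walk (last x (map (@dart_to R Q) w1)) w2 y.
Proof. by elim: w1 x => [|e w IH] x /=; rewrite ?eqxx// IH andbA. Qed.

Lemma node_pathP x y : simple_walk x (node_path x y) y.
Proof. by rewrite /node_path; case: cid => w /= []. Qed.

Lemma simple_walk_cat x w1 w2 y z : last x (map (@dart_to R Q) w1) = z ->
  simple_walk x (w1 ++ w2) y -> simple_walk x w1 z /\ simple_walk z w2 y.
Proof.
move=> lz; rewrite /simple_walk walk_cat lz => /andP[/andP[-> ->]] /=.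
rewrite map_cat mem_cat negb_or cat_uniq => /andP[/andP[x1 x2]].
case/and3P=> u1 dis u2; rewrite x1 u1 u2 !andbT; split=> //.
have := mem_last x (map (@dart_to R Q) w1); rewrite lz inE => /orP[/eqP -> //|z1].
by apply: contra dis => z2; apply/hasP; exists z.
Qed.

Lemma node_path_cat x y w1 w2 z : last x (map (@dart_to R Q) w1) = z ->
  node_path x y = w1 ++ w2 -> node_path x z = w1 /\ node_path z y = w2.
Proof.
move=> lz E; have := node_pathP x y; rewrite E => /(simple_walk_cat lz)[h1 h2].
by split; exact: node_pathE.
Qed.

Lemma node_path_refl x : node_path x x = [::].
Proof. by apply: node_pathE; rewrite /simple_walk /= eqxx. Qed.

Lemma node_path_from x y e w : node_path x y = e :: w ->
  dart_from e = x /\ node_path (dart_to e) y = w.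
Proof.
move=> E; have := node_pathP x y; rewrite E => /andP[/andP[/eqP fe _] _].
by split=> //; have [] := @node_path_cat x y [:: e] w _ erefl E.
Qed.

(** If the path from the far end of [e] avoids its near end, then [e] can be
    put in front of it; otherwise it visits the near end, and by uniqueness it
    gets there in one step. *)
Lemma node_path_step e y :
  node_path (dart_from e) y = e :: node_path (dart_to e) y \/
  node_path (dart_to e) y = flip e :: node_path (dart_from e) y.
Proof.
set x := dart_from e; set x' := dart_to e; have nx : x != x' by exact: dart_neq.
have := node_pathP x' y; set w := node_path x' y => sw.
case/boolP: (x \in x' :: map (@dart_to R Q) w) => [xin|xnin]; last first.
  left; apply: node_pathE; case/andP: sw => ww uw.
  by rewrite /simple_walk /= -/x -/x' eqxx ww /= xnin.
right; move: xin; rewrite inE (negPf nx) /= => /mapP[e' e'w xe'].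
have [p1 [p2 Ew]] : exists p1 p2, w = rcons p1 e' ++ p2.
  by case/splitPr: e'w => p1 p2; exists p1, p2; rewrite cat_rcons.
have lx : last x' (map (@dart_to R Q) (rcons p1 e')) = x.
  by rewrite map_rcons last_rcons.
have sw' : simple_walk x' (rcons p1 e' ++ p2) y by rewrite -Ew.
have [_ s2] := simple_walk_cat lx sw'.
have x'n : x' \notin map (@dart_to R Q) p2.
  by case/andP: sw' => _ /= /andP[]; rewrite map_cat mem_cat negb_or => /andP[].
rewrite (node_pathE s2) /w; apply: node_pathE; case/andP: s2 => w2 u2.
rewrite /simple_walk /= dart_from_flip dart_to_flip -/x -/x' eqxx w2 /=.
by move: u2 => /= ->; rewrite inE negb_or (eq_sym x') nx x'n.
Qed.

Definition rev_walk w := rev (map flip w).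

Lemma rev_walk_cons e w : rev_walk (e :: w) = rcons (rev_walk w) (flip e).
Proof. by rewrite /rev_walk /= rev_cons. Qed.

Lemma walk_rev x w y : walk x w y -> walk y (rev_walk w) x.
Proof.
elim: w x => [|e w IH] x /=; first by rewrite eq_sym.
move=> /andP[/eqP <- /IH h]; rewrite rev_walk_cons -cats1 walk_cat.
by rewrite (walk_last h) h /= dart_from_flip dart_to_flip !eqxx.
Qed.

Lemma rev_walk_vertices x w y : walk x w y ->
  y :: map (@dart_to R Q) (rev_walk w) = rev (x :: map (@dart_to R Q) w).
Proof.
elim: w x => [|e w IH] x /=; first by move/eqP ->.
move=> /andP[/eqP <- /IH h]; rewrite rev_walk_cons map_rcons -rcons_cons h.
by rewrite [in RHS]rev_cons dart_to_flip.
Qed.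

Lemma node_path_rev x y : node_path y x = rev_walk (node_path x y).
Proof.
apply: node_pathE; have /andP[h u] := node_pathP x y.
by rewrite /simple_walk (walk_rev h) (rev_walk_vertices h) rev_uniq.
Qed.

(** Without the arc [a] the tree falls into two parts; [v] is in the part of
    [atgt a] when the path from [asrc a] to [v] has to begin with [a]. *)
Definition side a v := ohead (node_path (asrc a) v) == Some (a, true).

Lemma side_path a v : side a v ->
  node_path (asrc a) v = (a, true) :: node_path (atgt a) v.
Proof.
rewrite /side; case E: (node_path (asrc a) v) => [//|e w] /eqP[Ee].
by move: E; rewrite Ee => /node_path_from[_ ->].
Qed.

Lemma Nside_path a v : ~~ side a v ->
  node_path (atgt a) v = (a, false) :: node_path (asrc a) v.
Proof.
have := node_path_step (a, true) v; rewrite /dart_from /dart_to /side /=.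
by case=> -> //; rewrite /= eqxx.
Qed.

Lemma side_src a : side a (asrc a) = false.
Proof. by rewrite /side node_path_refl. Qed.

Lemma side_tgt a : side a (atgt a).
Proof.
apply/negPn/negP => /Nside_path; by rewrite node_path_refl.
Qed.

Lemma side_dart e v : node_path (dart_from e) v = e :: node_path (dart_to e) v ->
  side e.1 v = e.2.
Proof.
case: e => a []; rewrite /dart_from /dart_to /= => E.
  by rewrite /side E /= eqxx.
apply/negP => /side_path E2; move: E; rewrite E2 => /(congr1 size) /= /eqP.
by rewrite -addn2 -[X in X == _]addn0 eqn_add2l.
Qed.

(** By uniqueness the paths from [asrc a] to the two ends of [e] differ by [e]
    only, hence start alike. *)
Lemma side_step a e : a != e.1 -> side a (dart_from e) = side a (dart_to e).
Proof.
move=> ae; rewrite /side.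
have rv z : node_path (asrc a) z = rev_walk (node_path z (asrc a)).
  exact: node_path_rev.
have [E|E] := node_path_step e (asrc a); rewrite !rv E rev_walk_cons.
  case: (rev_walk _) => [|e' p] //=.
  by apply/negbTE; apply: contra ae => /eqP[->].
case: (rev_walk _) => [|e' p] //=.
by apply/esym/negbTE; apply: contra ae; rewrite flipK => /eqP[->].
Qed.

Lemma side_arc a b : a != b -> side a (asrc b) = side a (atgt b).
Proof. by move=> ab; have := @side_step a (b, true) ab. Qed.

Lemma side_walk a x w y : walk x w y -> a \notin map fst w -> side a x = side a y.
Proof.
elim: w x => [|e w IH] x /=; first by move/eqP ->.
by move=> /andP[/eqP <- /IH h]; rewrite inE negb_or => /andP[/side_step -> /h].
Qed.

(** The position of the projection of a node on an arc. *)
Definition node_coord a v : R := if side a v then len a else 0.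

(** Every step of the path moves the projection on the arc that it uses, by
    the whole length of that arc and towards its final value, and leaves the
    other projections alone. *)
Lemma node_distE x y :
  node_dist x y = \sum_(a : arc Q) `|node_coord a x - node_coord a y|.
Proof.
rewrite /node_dist; move E: (node_path x y) => w.
elim: w x E => [|e w IH] x E.
  have /andP[] := node_pathP x y; rewrite E /= => /eqP -> _.
  by rewrite big_nil big1// => a _; rewrite subrr normr0.
have [fe E'] := node_path_from E; rewrite big_cons (IH _ E').
have sy : side e.1 y = e.2 by apply: side_dart; rewrite fe E E'.
have sx : side e.1 x = ~~ e.2.
  by rewrite -fe; case: (e) => a []; rewrite /dart_from /= ?side_src ?side_tgt.
have sx' : side e.1 (dart_to e) = e.2.
  by case: (e) => a []; rewrite /dart_to /= ?side_src ?side_tgt.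
rewrite (bigD1 e.1) //= [in RHS](bigD1 e.1) //= addrA; congr (_ + _).
  rewrite /node_coord sy sx sx'; have := len_gt0 e.1; case: (e.2) => l0 /=.
    by rewrite subrr normr0 addr0 sub0r normrN gtr0_norm.
  by rewrite subrr normr0 addr0 subr0 gtr0_norm.
by apply: eq_bigr => a ae; rewrite /node_coord -fe side_step.
Qed.

(** Distances add up at a node of the path, and the triangle inequality holds
    arc by arc. *)
Lemma node_coord_between x y w1 w2 z : last x (map (@dart_to R Q) w1) = z ->
  node_path x y = w1 ++ w2 -> forall a,
  `|node_coord a x - node_coord a y| =
  `|node_coord a x - node_coord a z| + `|node_coord a z - node_coord a y|.
Proof.
move=> lz E a; have [E1 E2] := node_path_cat lz E.
pose f c := `|node_coord c x - node_coord c z| + `|node_coord c z - node_coord c y|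
  - `|node_coord c x - node_coord c y|.
have f0 c : true -> 0 <= f c by move=> _; rewrite /f subr_ge0 ler_distD.
have : \sum_(c : arc Q) f c = 0.
  rewrite sumrB big_split /= -!node_distE /node_dist E E1 E2 big_cat /=.
  by rewrite subrr.
by move/(psumr_eq0P f0)/(_ a isT)/eqP; rewrite subr_eq0 => /eqP ->.
Qed.

(** Here [b] is not on the same side of [a] as [x]. Let [p] be the end of [a] on
    the side of [x]. If [b] separated [x] from [a], then the path from [x] to
    [p] would use [b], hence would visit the other side of [a] although both
    its ends are on the same one. *)
Lemma side_cross a b x : a != b -> side a x <> side a (asrc b) ->
  side b x = side b (asrc a).
Proof.
move=> ab sab; case: (eqVneq (side b x) (side b (asrc a))) => // /eqP sba; exfalso.
pose p := if side a x then atgt a else asrc a.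
have pb : side b p = side b (asrc a).
  by rewrite /p; case: ifP => // _; rewrite -side_arc// eq_sym.
have pa : side a p = side a x.
  by rewrite /p; case: ifP => // _; rewrite ?side_src ?side_tgt.
have bw : b \in map fst (node_path x p).
  apply/negPn/negP => bn; have /andP[h _] := node_pathP x p.
  by apply: sba; rewrite (side_walk h bn).
case/mapP: bw => e ew be.
have {ew}[w1 [w2 E]] : exists w1 w2, node_path x p = w1 ++ e :: w2.
  by case/splitPr: ew => w1 w2; exists w1, w2.
have /andP[hw _] := node_pathP x p.
have lz : last x (map (@dart_to R Q) w1) = dart_from e.
  by move: hw; rewrite E walk_cat => /andP[_ /= /andP[/eqP]].
have se : side a (dart_from e) = side a (asrc b).
  by rewrite be /dart_from; case: ifP => // _; rewrite -side_arc// -be.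
have := node_coord_between lz E a; rewrite /node_coord pa se subrr normr0.
move: sab; have la := len_gt0 a.
case: (side a x); case: (side a (asrc b)) => // _;
  rewrite ?sub0r ?subr0 ?normrN (gtr0_norm la); lra.
Qed.

End NodePaths.

(** * Embedding the tree into l^1 *)

Section Coordinates.
Context {R : realType} (Q : tree_network R).
Implicit Types (a b : arc Q) (v : node Q) (x y z : tree_point Q).

(** The position on the arc [a] of the projection of [x]. *)
Definition coord a x : R :=
  match x with
  | inl v => node_coord a v
  | inr p => if (val p).1 == a then (val p).2 else node_coord a (asrc (val p).1)
  end.

Lemma node_coord_cases a v : node_coord a v = 0 \/ node_coord a v = len a.
Proof. by rewrite /node_coord; case: ifP; [right|left]. Qed.

Lemma node_coord_bounds a v : 0 <= node_coord a v <= len a.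
Proof.
have := len_gt0 a; case: (node_coord_cases a v) => ->; rewrite lexx ?andbT => /ltW //.
Qed.

Lemma node_coord_src a : node_coord a (asrc a) = 0.
Proof. by rewrite /node_coord side_src. Qed.

Lemma node_coord_tgt a : node_coord a (atgt a) = len a.
Proof. by rewrite /node_coord side_tgt. Qed.

Lemma node_coord_arc a b : a != b -> node_coord b (atgt a) = node_coord b (asrc a).
Proof. by move=> ab; rewrite /node_coord -side_arc// eq_sym. Qed.

Lemma coord_bounds a x : 0 <= coord a x <= len a.
Proof.
case: x => [v|p] /=; first exact: node_coord_bounds.
case: eqP => [<-|_]; last exact: node_coord_bounds.
by case/andP: (valP p) => /ltW -> /ltW ->.
Qed.

Lemma coord_ge0 a x : 0 <= coord a x.
Proof. by case/andP: (coord_bounds a x). Qed.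

Lemma coord_le a x : coord a x <= len a.
Proof. by case/andP: (coord_bounds a x). Qed.

Let K a x y := \sum_(b | b != a) `|coord b x - coord b y|.

Let sumK a x y :
  \sum_b `|coord b x - coord b y| = K a x y + `|coord a x - coord a y|.
Proof. by rewrite (bigD1 a) //= addrC. Qed.

Let minK (k s l c : R) : 0 < l -> 0 <= s <= l -> c = 0 \/ c = l ->
  Num.min (k + `|c - 0| + s) (k + `|c - l| + (l - s)) = k + `|c - s|.
Proof.
move=> l0 /andP[s0 sl] [->|->]; rewrite ?subrr ?sub0r ?subr0 ?normrN ?normr0.
  by rewrite !ger0_norm ?(ltW l0)// min_l; lra.
by rewrite ger0_norm ?(ltW l0)// (@ger0_norm _ (l - s)) ?subr_ge0// min_r; lra.
Qed.

Lemma node_point_distE v y :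
  node_point_dist v y = \sum_a `|coord a (Node v) - coord a y|.
Proof.
case: y => [w|[[a s] sP]]; first exact: node_distE.
set x : tree_point Q := inr _.
rewrite (sumK a) [X in _ = _ + X]/= eqxx /= !node_distE.
have k1 : \sum_b `|node_coord b v - node_coord b (asrc a)| =
    K a (Node v) x + `|node_coord a v - 0|.
  rewrite (sumK a (Node v) (Node (asrc a))) /= node_coord_src; congr (_ + _).
  by apply: eq_bigr => b ba /=; rewrite eq_sym (negPf ba).
have k2 : \sum_b `|node_coord b v - node_coord b (atgt a)| =
    K a (Node v) x + `|node_coord a v - len a|.
  rewrite (sumK a (Node v) (Node (atgt a))) /= node_coord_tgt; congr (_ + _).
  by apply: eq_bigr => b ba /=; rewrite eq_sym (negPf ba) node_coord_arc// eq_sym.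
rewrite k1 k2 minK//; [exact: len_gt0| |exact: node_coord_cases].
by case/andP: (sP) => /ltW -> /ltW ->.
Qed.

(** The projections on the arcs embed the tree isometrically into l^1: all the
    geometry of the tree is reduced to one real function for each arc. *)
Lemma distE x y : dist x y = \sum_a `|coord a x - coord a y|.
Proof.
case: x => [v|[[a s] sP]]; first by rewrite /dist node_point_distE.
set x : tree_point Q := inr _.
have la := len_gt0 a.
have sb : 0 <= s <= len a by case/andP: (sP) => /= /ltW -> /ltW ->.
have xa : coord a x = s by rewrite /= eqxx.
have end1 y' : coord a y' = 0 \/ coord a y' = len a ->
   Num.min (s + node_point_dist (asrc a) y') (len a - s + node_point_dist (atgt a) y')
   = \sum_b `|coord b x - coord b y'|.
  move=> cy; rewrite !node_point_distE !(sumK a) xa /= node_coord_src node_coord_tgt.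
  have k1 : K a (Node (asrc a)) y' = K a x y'.
    by apply: eq_bigr => b ba /=; rewrite eq_sym (negPf ba).
  have k2 : K a (Node (atgt a)) y' = K a x y'.
    by apply: eq_bigr => b ba /=; rewrite eq_sym (negPf ba) node_coord_arc// eq_sym.
  rewrite k1 k2 [`|s - _|]distrC -(minK (K a x y') la sb cy).
  by rewrite (distrC (coord a y') 0) (distrC (coord a y') (len a));
     congr Num.min; rewrite addrC.
case: y => [w|[[b t] tP]].
  by apply: (end1 (inl w)); exact: node_coord_cases.
rewrite [LHS]/=; case: eqVneq => [ba|ba].
  subst b; rewrite (sumK a) /= !eqxx [K _ _ _]big1 ?add0r// => c ca.
  by rewrite /= eq_sym (negPf ca) subrr normr0.
apply: (end1 (inr (exist _ (b, t) tP))); rewrite /= (negPf ba); exact: node_coord_cases.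
Qed.

Lemma dist_refl x : dist x x = 0.
Proof. by rewrite distE big1// => a _; rewrite subrr normr0. Qed.

Lemma dist_ge0 x y : 0 <= dist x y.
Proof. by rewrite distE sumr_ge0. Qed.

Lemma dist_sym x y : dist x y = dist y x.
Proof. by rewrite !distE; apply: eq_bigr => a _; rewrite distrC. Qed.

Lemma dist_triangle x y z : dist x z <= dist x y + dist y z.
Proof. by rewrite !distE -big_split ler_sum// => a _; rewrite ler_distD. Qed.

Lemma coord_lipschitz a x y : `|coord a x - coord a y| <= dist x y.
Proof. by rewrite distE (bigD1 a) //= lerDl sumr_ge0. Qed.

Lemma arc_point_in a s : 0 < s < len a ->
  exists p, arc_point a s = inr p /\ val p = (a, s).
Proof.
move=> sP; rewrite /arc_point; case: insubP => [p _ pE|]; first by exists p.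
by rewrite /= sP.
Qed.

Lemma arc_point0 a : arc_point a 0 = Node (asrc a).
Proof. by rewrite /arc_point insubF /= ?ltxx// lexx. Qed.

Lemma arc_point_len a : arc_point a (len a) = Node (atgt a).
Proof. by rewrite /arc_point insubF /= ?ltxx ?andbF// leNgt len_gt0. Qed.

Lemma coord_arc_point a s b : 0 <= s <= len a ->
  coord b (arc_point a s) = if a == b then s else node_coord b (asrc a).
Proof.
case/andP; rewrite le_eqVlt => /predU1P[<-{s} _|s0].
  by rewrite arc_point0 /=; case: eqP => // <-; rewrite node_coord_src.
rewrite le_eqVlt => /predU1P[->|sl].
  rewrite arc_point_len /=; case: eqVneq => [<-|ab]; first exact: node_coord_tgt.
  by rewrite node_coord_arc.
by have [|p [-> /= ->]] := @arc_point_in a s; rewrite ?s0.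
Qed.

Lemma coordK a x : 0 < coord a x < len a -> arc_point a (coord a x) = x.
Proof.
case: x => [v|p] /=.
  by case: (node_coord_cases a v) => ->; rewrite ltxx ?andbF.
case: eqP => [<- h|_]; last first.
  by case: (node_coord_cases a (asrc (val p).1)) => ->; rewrite ltxx ?andbF.
have [q [-> qE]] := arc_point_in h; congr inr; apply: val_inj.
by rewrite qE; case: (p) => [[? ?] ?].
Qed.

Lemma dist_eq0 x y : dist x y = 0 -> x = y.
Proof.
move=> h; have cE a : coord a x = coord a y.
  apply/eqP; rewrite -subr_eq0 -normr_le0 -h; exact: coord_lipschitz.
have inE z w : (forall a, coord a z = coord a w) -> forall p, z = inr p -> z = w.
  move=> zw p zp; have pb : 0 < coord (val p).1 z < len (val p).1.
    by rewrite zp /= eqxx; exact: (valP p).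
  by rewrite -[z](coordK pb) zw coordK// -zw.
case: x y h cE inE => [v|p] [w|q] h cE inE; last 3 first.
- by apply/esym; apply: (inE _ _ _ q) => // a; rewrite cE.
- exact: (inE _ _ _ p).
- exact: (inE _ _ _ p).
congr inl; have /andP[] := node_pathP v w.
move: h; rewrite /= /node_dist; case: node_path => [_ /eqP //|e s].
move/eqP; rewrite big_cons paddr_eq0 ?sumr_ge0// ?(ltW (len_gt0 _))//.
  by rewrite gt_eqF ?len_gt0.
by move=> e' _; rewrite ltW ?len_gt0.
Qed.

(** The image of the tree under two of the projections is a cross: one has to
    be back at the point of [a] nearest to [b] before moving along [b]. *)
Lemma coord_cross a b x : a != b ->
  coord a x = node_coord a (asrc b) \/ coord b x = node_coord b (asrc a).
Proof.
move=> ab; have nodeP v : node_coord a v = node_coord a (asrc b) \/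
    node_coord b v = node_coord b (asrc a).
  rewrite /node_coord; case: (eqVneq (side a v) (side a (asrc b))) => [->|/eqP h].
    by left.
  by right; rewrite (side_cross ab h).
case: x => [v|p] /=; first exact: nodeP.
case: (eqVneq (val p).1 a) => [->|pa]; first by rewrite (negPf ab); right.
case: (eqVneq (val p).1 b) => [->|pb]; first by left.
exact: nodeP.
Qed.

End Coordinates.

(** * Arms of the rooted tree *)

Section Arms.
Context {R : realType} (Q : tree_network R) (O : tree_point Q).
Implicit Types (a b : arc Q) (v : node Q) (x y z : tree_point Q).
Implicit Types (e : arc Q * bool) (c : R).

(** The arm [e] is the part of the arc [e.1] on one side of the projection of
    the root, oriented away from the root; one of the two arms of an arc is
    reduced to a point unless the root is interior to that arc. *)
Definition arm_len e : R :=
  if e.2 then len e.1 - coord e.1 O else coord e.1 O.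

Definition arm_coord e x : R :=
  Num.max 0 (if e.2 then coord e.1 x - coord e.1 O else coord e.1 O - coord e.1 x).

Definition arm_point e c : tree_point Q :=
  arc_point e.1 (if e.2 then coord e.1 O + c else coord e.1 O - c).

Definition out e : leg Q := (e.1, coord e.1 O, if e.2 then len e.1 else 0).
Definition inn e : leg Q := leg_rev (out e).

Lemma arm_len_ge0 e : 0 <= arm_len e.
Proof.
by rewrite /arm_len; case: ifP => _; rewrite ?subr_ge0 ?coord_le ?coord_ge0.
Qed.

Lemma arm0P e : 0 <= (0 : R) <= arm_len e.
Proof. by rewrite lexx arm_len_ge0. Qed.

Lemma armlP e : 0 <= arm_len e <= arm_len e.
Proof. by rewrite lexx arm_len_ge0. Qed.

Lemma arm_coord_ge0 e x : 0 <= arm_coord e x.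
Proof. by rewrite le_max lexx. Qed.

Lemma arm_coord_le e x : arm_coord e x <= arm_len e.
Proof.
rewrite ge_max arm_len_ge0 /= /arm_len; case: ifP => _.
  by rewrite lerD2r coord_le.
by rewrite gerBl coord_ge0.
Qed.

Lemma sum_arms (f : arc Q * bool -> R) :
  \sum_e f e = \sum_a (f (a, true) + f (a, false)).
Proof.
rewrite (eq_bigr (fun e => f (e.1, e.2))); last by case.
rewrite -(pair_bigA _ (fun a (c : bool) => f (a, c))) /=.
by apply: eq_bigr => a _; rewrite big_bool.
Qed.

Lemma arm_coordB a x y :
  `|arm_coord (a, true) x - arm_coord (a, true) y| +
  `|arm_coord (a, false) x - arm_coord (a, false) y| =
  `|coord a x - coord a y|.
Proof.
rewrite /arm_coord /=; move: (coord a x) (coord a y) (coord a O) => p q o.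
by case: (ltP 0 (p - o)); case: (ltP 0 (q - o)); case: (ltP 0 (o - p));
  case: (ltP 0 (o - q)); case: (lerP p q) => *;
  do 2? first [rewrite ler0_norm; last lra | rewrite ger0_norm; last lra]; lra.
Qed.

Lemma arm_distE x y : dist x y = \sum_e `|arm_coord e x - arm_coord e y|.
Proof. by rewrite distE sum_arms; apply: eq_bigr => a _; rewrite arm_coordB. Qed.

Lemma arm_coord_root e : arm_coord e O = 0.
Proof. by rewrite /arm_coord !subrr if_same maxxx. Qed.

Lemma dist_root x : dist O x = \sum_e arm_coord e x.
Proof.
rewrite arm_distE; apply: eq_bigr => e _.
by rewrite arm_coord_root sub0r normrN ger0_norm ?arm_coord_ge0.
Qed.

Lemma arm_lipschitz e x y : `|arm_coord e x - arm_coord e y| <= dist x y.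
Proof. by rewrite arm_distE (bigD1 e) //= lerDl sumr_ge0. Qed.

Lemma sum_arm_len : \sum_e arm_len e = total_length Q.
Proof.
by rewrite sum_arms; apply: eq_bigr => a _; rewrite /arm_len /= subrK.
Qed.

Lemma arm_param e c : 0 <= c <= arm_len e ->
  0 <= (if e.2 then coord e.1 O + c else coord e.1 O - c) <= len e.1.
Proof.
have /andP[r0 rl] := coord_bounds e.1 O; rewrite /arm_len.
by case: ifP => _ /andP[c0 cl]; apply/andP; split; lra.
Qed.

Lemma coord_arm_point e c : 0 <= c <= arm_len e ->
  coord e.1 (arm_point e c) = if e.2 then coord e.1 O + c else coord e.1 O - c.
Proof. by move=> /arm_param h; rewrite coord_arc_point// eqxx. Qed.

Lemma coord_arm_point_other b e c : e.1 != b -> 0 <= c <= arm_len e ->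
  coord b (arm_point e c) = node_coord b (asrc e.1).
Proof. by move=> /negPf eb /arm_param h; rewrite coord_arc_point// eb. Qed.

Lemma arm_coordK e c : 0 <= c <= arm_len e -> arm_coord e (arm_point e c) = c.
Proof.
move=> ch; rewrite /arm_coord coord_arm_point//; case/andP: ch => c0 _.
by case: (e.2); rewrite max_r; lra.
Qed.

Lemma arm_coord_other e e' c : e' != e -> 0 <= c <= arm_len e ->
  arm_coord e' (arm_point e c) = arm_coord e' (arm_point e 0).
Proof.
move=> ee ch; have c0 := arm0P e.
case: (eqVneq e.1 e'.1) => [E|ne]; last first.
  by rewrite /arm_coord !coord_arm_point_other.
rewrite /arm_coord -E !coord_arm_point//.
have -> : e'.2 = ~~ e.2.
  move: ee E; case: (e) (e') => [a []] [b []] //= h E; move: h; rewrite E;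
  by rewrite eqxx.
by case/andP: ch => ? _; case: (e.2) => /=; rewrite !max_l; lra.
Qed.

Lemma arm_pointK e x : 0 < arm_coord e x < arm_len e ->
  arm_point e (arm_coord e x) = x.
Proof.
have /andP[r0 rl] := coord_bounds e.1 O.
rewrite /arm_coord /arm_len /arm_point lt_max ltxx /= gt_max.
case: ifP => _ /andP[h0 /andP[_ h1]]; rewrite max_r ?(ltW h0)//.
  by rewrite subrKC coordK//; apply/andP; split; lra.
by rewrite subKr coordK//; apply/andP; split; lra.
Qed.

Lemma dist_arm_point e c c' : 0 <= c <= arm_len e -> 0 <= c' <= arm_len e ->
  dist (arm_point e c) (arm_point e c') = `|c - c'|.
Proof.
move=> ch ch'; rewrite arm_distE (bigD1 e) //= !arm_coordK// big1 ?addr0//.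
by move=> e' ee; rewrite !arm_coord_other// subrr normr0.
Qed.

Lemma depth_arm_point e c : 0 <= c <= arm_len e ->
  dist O (arm_point e c) = dist O (arm_point e 0) + c.
Proof.
move=> ch; have c0 := arm0P e.
rewrite !dist_root (bigD1 e) //= [in RHS](bigD1 e) //= !arm_coordK// add0r addrC.
by congr (_ + _); apply: eq_bigr => e' ee; rewrite arm_coord_other.
Qed.

(** The path from the root to [x] uses the arm [e], hence goes through its near
    end: on every other arm that has been entered before [e], both [x] and the
    near end of [e] have the same projection. *)
Lemma arm_coord_start_le e e' x : 0 < arm_coord e x ->
  arm_coord e' (arm_point e 0) <= arm_coord e' x.
Proof.
move=> gx; have c0 := arm0P e.
case: (eqVneq e.1 e'.1) => [E|ne].
  rewrite {1}/arm_coord -E coord_arm_point// addr0 subr0 if_same.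
  by rewrite subrr if_same maxxx arm_coord_ge0.
have xO : coord e.1 x <> coord e.1 O.
  by move=> h; move: gx; rewrite /arm_coord h subrr if_same maxxx ltxx.
have E := coord_arm_point_other ne c0.
have [h|h] := coord_cross O ne; last first.
  by rewrite {1}/arm_coord E -h subrr if_same maxxx arm_coord_ge0.
have [h'|h'] := coord_cross x ne; first by case: xO; rewrite h h'.
by rewrite /arm_coord E h'.
Qed.

Lemma depth_ge_arm e x : 0 < arm_coord e x ->
  dist O (arm_point e 0) + arm_coord e x <= dist O x.
Proof.
move=> gx; have c0 := arm0P e.
rewrite !dist_root (bigD1 e) //= [in leRHS](bigD1 e) //= arm_coordK// add0r.
by rewrite [leLHS]addrC lerD2l ler_sum// => e' _; rewrite arm_coord_start_le.
Qed.

(** The two arms of an arc both start at the projection of the root, so neither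
    of them continues the other. *)
Lemma arm_child_neq e e' : 0 < arm_len e ->
  arm_point e (arm_len e) = arm_point e' 0 -> e.1 != e'.1.
Proof.
move=> l0 h; apply/eqP => E.
have c0 := arm0P e'.
have c1 := armlP e.
have := coord_arm_point c1; rewrite h E coord_arm_point//.
by case: ifP => _; case: ifP => _; lra.
Qed.

(** By [coord_cross], a point that is off the near end of [e'] projects on the
    arc of [e] where the arc of [e'] does, that is, at the far end of [e]. *)
Lemma arm_coord_child e e' x : 0 < arm_len e ->
  arm_point e (arm_len e) = arm_point e' 0 ->
  arm_coord e x < arm_len e -> arm_coord e' x = 0.
Proof.
move=> l0 h gx; have ne := arm_child_neq l0 h.
have c0 := arm0P e'.
have c1 := armlP e.
have [h'|h'] := coord_cross x ne.
  move: gx; rewrite -[ltRHS](arm_coordK c1) h /arm_coord h'.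
  by rewrite coord_arm_point_other 1?eq_sym// ltxx.
rewrite /arm_coord h' -(coord_arm_point_other ne c1) h coord_arm_point//.
by rewrite addr0 subr0 if_same subrr if_same maxxx.
Qed.

(** Two arms with the same far end would both separate the root from it, hence
    each of them would separate the root from the other one. *)
Lemma arm_end_inj e e' : 0 < arm_len e -> 0 < arm_len e' ->
  arm_point e (arm_len e) = arm_point e' (arm_len e') -> e = e'.
Proof.
move=> l0 l0' h.
have c1 := armlP e.
have c2 := armlP e'.
case: (eqVneq e.1 e'.1) => [E|ne].
  have := coord_arm_point c1; rewrite h E coord_arm_point//.
  move: l0 l0' E; case: (e) (e') {h c1 c2} => [a []] [b []] /= l0 l0' E;
    subst b => // H; exfalso; lra.
exfalso; have n1 : coord e.1 (arm_point e (arm_len e)) <> coord e.1 O.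
  by rewrite coord_arm_point//; case: ifP => _; lra.
have n2 : coord e'.1 (arm_point e' (arm_len e')) <> coord e'.1 O.
  by rewrite coord_arm_point//; case: ifP => _; lra.
have [h'|h'] := coord_cross O ne.
  by apply: n1; rewrite h h' coord_arm_point_other// eq_sym.
by apply: n2; rewrite -h h' coord_arm_point_other.
Qed.

(** The arm sought is that of the last arc on the path from the root to [v]. *)
Lemma arm_to_node v : Node v != O ->
  exists e, 0 < arm_len e /\ arm_point e (arm_len e) = Node v.
Proof.
move=> vO; suff [a [av ca]] : exists a, incident a v /\ coord a O <> node_coord a v.
  have /andP[r0 rl] := coord_bounds a O.
  case/orP: av => /eqP av; [exists (a, false)|exists (a, true)]; move: ca;
    rewrite -av /arm_point /arm_len /= ?node_coord_src ?node_coord_tgt => /eqP ca.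
    by rewrite subrr arc_point0 lt_neqAle eq_sym ca r0.
  by rewrite subrKC arc_point_len subr_gt0 lt_neqAle ca rl.
have nodeP o : o != v -> exists a, incident a v /\ node_coord a o <> node_coord a v.
  move=> ov; have /andP[] := node_pathP v o.
  case E: (node_path v o) => [|e w] /=; first by rewrite eq_sym (negPf ov).
  have [fe E'] := node_path_from E.
  move=> _ _; exists e.1; split.
    by rewrite /incident -fe /dart_from; case: (e.2); rewrite eqxx ?orbT.
  rewrite /node_coord (side_dart (e := e) (v := o)); last by rewrite fe E E'.
  have -> : side e.1 v = ~~ e.2.
    by rewrite -fe /dart_from; case: (e) => a []; rewrite /= ?side_src ?side_tgt.
  by have := len_gt0 e.1; case: (e.2) => /= h0 h1; move: h0; rewrite h1 ltxx.
case: O vO => [v0|p] vO /=.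
  by apply: nodeP; apply: contra vO => /eqP ->.
case: (boolP (incident (val p).1 v)) => [inc|ninc].
  exists (val p).1; split; rewrite // eqxx; have /andP[] := valP p.
  by case: (node_coord_cases (val p).1 v) => -> h0 h1 h2; move: h0 h1; rewrite h2 ltxx.
have ov : asrc (val p).1 != v.
  by apply: contra ninc; rewrite /incident => ->.
have [a [av h]] := nodeP _ ov; exists a; split=> //; case: eqP => // E.
by move: ninc; rewrite E av.
Qed.

Lemma arm_start_cases e : arm_point e 0 = O \/ exists v, arm_point e 0 = Node v.
Proof.
rewrite /arm_point addr0 subr0 if_same.
have nodeP v : exists w, arc_point e.1 (node_coord e.1 v) = Node w.
  case: (node_coord_cases e.1 v) => ->; rewrite ?arc_point0 ?arc_point_len;
  by eexists.
case E: O => [v0|p] /=; first by right.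
case: eqP => [pe|_]; last by right.
left; rewrite -E -[RHS](@coordK _ _ e.1) E /= -pe eqxx //; exact: (valP p).
Qed.

Lemma arm_point_interior a x : 0 < coord a x < len a -> x <> O ->
  exists e c, 0 < c <= arm_len e /\ arm_point e c = x.
Proof.
move=> xa xO; case: (ltgtP (coord a x) (coord a O)) => h.
- exists (a, false), (coord a O - coord a x).
  by rewrite /arm_len /arm_point /= subKr coordK// subr_gt0 h gerBl coord_ge0.
- exists (a, true), (coord a x - coord a O).
  by rewrite /arm_len /arm_point /= subrKC coordK// subr_gt0 h lerD2r coord_le.
by case: xO; rewrite -(coordK xa) h coordK// -h.
Qed.

Lemma arm_point_surj x : x <> O ->
  exists e c, 0 < c <= arm_len e /\ arm_point e c = x.
Proof.
case: x => [v|p] xO.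
  have [|e [l0 E]] := @arm_to_node v; first exact/eqP.
  by exists e, (arm_len e); rewrite l0 lexx E.
by apply: (@arm_point_interior (val p).1) => //=; rewrite eqxx; exact: (valP p).
Qed.

Lemma leg_len_out e : leg_len (out e) = arm_len e.
Proof.
have /andP[r0 rl] := coord_bounds e.1 O.
rewrite /leg_len /out /arm_len /=; case: ifP => _.
  by rewrite ger0_norm ?subr_ge0.
by rewrite sub0r normrN ger0_norm.
Qed.

Lemma leg_len_inn e : leg_len (inn e) = arm_len e.
Proof. by rewrite -leg_len_out /leg_len /inn /= distrC. Qed.

Lemma leg_at_out e c : 0 < arm_len e -> leg_at (out e) c = arm_point e c.
Proof.
rewrite /leg_at /out /arm_point /arm_len /=; case: ifP => _ h.
  by rewrite gtr0_sg// mul1r.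
by rewrite sub0r sgrN gtr0_sg// mulN1r.
Qed.

Lemma leg_at_inn e c : 0 < arm_len e ->
  leg_at (inn e) c = arm_point e (arm_len e - c).
Proof.
rewrite /leg_at /inn /leg_rev /out /arm_point /arm_len /=; case: ifP => _ h.
  by rewrite -opprB sgrN gtr0_sg// mulN1r; congr arc_point; lra.
by rewrite subr0 gtr0_sg// mul1r; congr arc_point; lra.
Qed.

Lemma leg_start_out e : leg_start (out e) = arm_point e 0.
Proof. by rewrite /leg_start /out /arm_point addr0 subr0 if_same. Qed.

Lemma leg_end_out e : leg_end (out e) = arm_point e (arm_len e).
Proof.
rewrite /leg_end /out /arm_point /arm_len /=; case: ifP => _; rewrite ?subrr//.
by rewrite subrKC.
Qed.

Lemma leg_start_inn e : leg_start (inn e) = arm_point e (arm_len e).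
Proof. by rewrite -leg_end_out. Qed.

Lemma leg_end_inn e : leg_end (inn e) = arm_point e 0.
Proof. by rewrite -leg_start_out. Qed.

Lemma out_inj : injective out.
Proof.
move=> [a b] [a' b'] /= [<- _]; have := len_gt0 a.
by case: b; case: b' => //=; [|move=> + /esym]; move/gt_eqF/eqP.
Qed.

Lemma leg_revK : involutive (@leg_rev R Q).
Proof. by case=> [[a s] t]. Qed.

Lemma towards_root_inn e : 0 < arm_len e -> towards_root O (inn e).
Proof.
move=> l0; rewrite /towards_root leg_start_inn leg_end_inn.
by rewrite [ltRHS]depth_arm_point ?ltrDl// lexx ltW.
Qed.

Lemma towards_root_out e : towards_root O (out e) = false.
Proof.
rewrite /towards_root leg_start_out leg_end_out [ltLHS]depth_arm_point.
  by apply/negbTE; rewrite -leNgt lerDl arm_len_ge0.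
by rewrite lexx arm_len_ge0.
Qed.

Lemma out_neq_inn e e' : 0 < arm_len e' -> out e != inn e'.
Proof.
by move=> l0; apply/eqP => h; have := towards_root_out e; rewrite h towards_root_inn.
Qed.

Lemma rooted_arcs_lt l : l \in rooted_arcs O -> l.1.2 < l.2.
Proof.
rewrite /rooted_arcs; case: (O) => [v0 /mapP[a _ ->]|[[a0 s0] /= /andP[h0 h1]]].
  exact: len_gt0.
rewrite !inE => /or3P[/eqP -> //|/eqP -> //|/mapP[a _ -> /=]]; exact: len_gt0.
Qed.

Lemma rooted_legs_uniq : uniq (rooted_legs O).
Proof.
have u : uniq (rooted_arcs O).
  rewrite /rooted_arcs; case: (O) => [v0|[[a0 s0] h0]].
    by rewrite map_inj_uniq ?enum_uniq// => a b [].
  have us : uniq [seq a <- enum (arc Q) | a != a0].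
    by rewrite filter_uniq ?enum_uniq.
  have s0F : (s0 == 0) = false by case/andP: h0 => /= /gt_eqF.
  have mF (s t : R) : (a0, s, t) \notin [seq (a, 0, len a) | a <- enum (arc Q) & a != a0].
    by apply/mapP => -[a]; rewrite mem_filter => /andP[/eqP aa _] [/esym].
  rewrite [val _]/= 2!cons_uniq inE negb_or !mF andbT map_inj_uniq ?us ?andbT.
    by apply/eqP => -[/eqP]; rewrite eq_sym s0F.
  by move=> a b [].
rewrite /rooted_legs cat_uniq u map_inj_uniq ?u ?andbT /=; last first.
  exact: (can_inj leg_revK).
apply/hasPn => _ /mapP[l lr ->]; apply/negP => /rooted_arcs_lt /=.
by have := rooted_arcs_lt lr; move=> /lt_trans h /h; rewrite ltxx.
Qed.

Lemma rooted_arcs_arm l : l \in rooted_arcs O ->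
  exists2 e, 0 < arm_len e & l = if e.2 then out e else inn e.
Proof.
have nodeP a : coord a O = 0 \/ coord a O = len a -> exists2 e, 0 < arm_len e &
    (a, 0, len a) = if e.2 then out e else inn e.
  move=> [h|h]; [exists (a, true)|exists (a, false)];
  by rewrite /arm_len /inn /leg_rev /out /= h ?subr0 ?len_gt0.
rewrite /rooted_arcs; case E: O => [v0|[[a0 s0] h]].
  move=> /mapP[a _ ->]; apply: nodeP; rewrite E /=; exact: node_coord_cases.
have c0 : coord a0 O = s0 by rewrite E /= eqxx.
rewrite !inE => /or3P[/eqP ->|/eqP ->|/mapP[a + ->]].
- exists (a0, false); rewrite /arm_len /inn /leg_rev /out /= c0//.
  by case/andP: (h).
- exists (a0, true); rewrite /arm_len /inn /leg_rev /out /= c0// subr_gt0.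
  by case/andP: (h).
rewrite mem_filter => /andP[aa _]; apply: nodeP; rewrite E /= eq_sym (negPf aa).
exact: node_coord_cases.
Qed.

Lemma arm_in_rooted_arcs e : 0 < arm_len e ->
  (if e.2 then out e else inn e) \in rooted_arcs O.
Proof.
have nodeP : coord e.1 O = 0 \/ coord e.1 O = len e.1 -> 0 < arm_len e ->
    (if e.2 then out e else inn e) = (e.1, 0, len e.1).
  by rewrite /arm_len /inn /leg_rev /out /=; case: ifP => _ [->|->];
     rewrite ?subrr ?ltxx.
move=> l0; rewrite /rooted_arcs; case E: O => [v0|[[a0 s0] h]].
  rewrite nodeP//; last by rewrite E /=; exact: node_coord_cases.
  by rewrite map_f ?mem_enum.
case: (eqVneq a0 e.1) => [ae|ae].
  have c0 : coord e.1 O = s0 by rewrite E /= ae eqxx.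
  rewrite /inn /leg_rev /out /= c0 !inE ae.
  by case: (e.2); rewrite !eqxx ?orbT.
rewrite nodeP//; last by rewrite E /= (negPf ae); exact: node_coord_cases.
by rewrite !inE map_f ?orbT// mem_filter eq_sym ae mem_enum.
Qed.

Lemma rooted_legsP l : reflect
  (exists2 e, 0 < arm_len e & l = out e \/ l = inn e) (l \in rooted_legs O).
Proof.
apply: (iffP idP); rewrite mem_cat.
  case/orP => [/rooted_arcs_arm[e l0 ->]|/mapP[l' /rooted_arcs_arm[e l0 ->] ->]].
    by exists e => //; case: ifP; [left|right].
  by exists e => //; case: ifP; [right|left]; rewrite // /inn leg_revK.
case=> e /arm_in_rooted_arcs h H; apply/orP; move: h H.
case: ifP => _ h [->|->]; [by left|right|right|by left].
  exact: map_f.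
by rewrite -(leg_revK (out e)) map_f.
Qed.

End Arms.

(** * The slack of a Lipschitz path *)

Section PathVariation.
Context {R : realType}.
Implicit Types (f : R -> R) (s t u : R) (l : seq R).

Fixpoint path_variation f s l : R :=
  if l is u :: l' then `|f u - f s| + path_variation f u l' else 0.

Lemma path_variation_ge f s l : `|f (last s l) - f s| <= path_variation f s l.
Proof.
elim: l s => [|u l IH] s /=; first by rewrite subrr normr0.
by rewrite [leRHS]addrC (le_trans (ler_distD (f u) _ _))// lerD2r.
Qed.

Lemma path_variation_ge2 f s l u : u \in l ->
  `|f u - f s| + `|f (last s l) - f u| <= path_variation f s l.
Proof.
elim: l s => [//|v l IH] s; rewrite inE => /predU1P[->|ul] /=.
  by rewrite lerD2l path_variation_ge.
rewrite (le_trans _ (lerD (lexx _) (IH v ul)))// addrA lerD2r [leRHS]addrC.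
exact: ler_distD.
Qed.

Lemma lipschitz_continuous f : (forall s t, `|f s - f t| <= `|s - t|) ->
  continuous f.
Proof.
move=> lf t; apply/cvgrPdist_lt => eps e0; near=> u.
apply: le_lt_trans (lf t u) _; near: u.
by apply/nbhs_ballP; exists eps.
Unshelve. all: by end_near. Qed.

End PathVariation.

Section LipschitzSearch.
Local Open Scope classical_set_scope.
Context {R : realType} (Q : tree_network R) (O : tree_point Q).
Variable S : R -> tree_point Q.
Hypothesis S0 : S 0 = O.
Hypothesis Slip : forall t1 t2, 0 <= t1 -> t1 < t2 ->
  dist (S t1) (S t2) <= t2 - t1.
Implicit Types (e : arc Q * bool) (x : tree_point Q) (s t u c : R).

Let d e t := arm_coord O e (S t).

Lemma search_lip s t : 0 <= s -> s <= t -> dist (S s) (S t) <= t - s.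
Proof.
move=> s0; rewrite le_eqVlt => /predU1P[<-|]; last exact: Slip.
by rewrite dist_refl subrr.
Qed.

(* Freezing the search at negative times makes it Lipschitz on the line. *)
Let S' t := S (Num.max 0 t).

Let S'E t : 0 <= t -> S' t = S t.
Proof. by move=> t0; rewrite /S' max_r. Qed.

Let S'lip s t : dist (S' s) (S' t) <= `|s - t|.
Proof.
wlog st : s t / s <= t.
  move=> h; case: (leP s t) => [/h //|/ltW /h]; by rewrite dist_sym distrC.
have := @search_lip (Num.max 0 s) (Num.max 0 t); rewrite le_max lexx => /(_ isT).
rewrite ge_max !le_max lexx st orbT => /(_ isT) h; rewrite (le_trans h)//.
rewrite ler0_norm ?subr_le0// opprB.
by case: (leP 0 s); case: (leP 0 t); lra.
Qed.

Let arm_cont e : continuous (fun t => arm_coord O e (S' t)).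
Proof.
apply: lipschitz_continuous => s t.
exact: le_trans (arm_lipschitz _ _ _ _) (S'lip _ _).
Qed.

Let dist_cont x : continuous (fun t => dist x (S' t)).
Proof.
apply: lipschitz_continuous => s t; apply: le_trans (S'lip s t).
have h1 := dist_triangle x (S' s) (S' t); have h2 := dist_triangle x (S' t) (S' s).
rewrite (dist_sym (S' t)) in h2; rewrite ler_norml; apply/andP; split; lra.
Qed.

Lemma arm_argmax e s t : 0 <= s -> s <= t ->
  exists2 u, s <= u <= t & forall v, s <= v <= t -> d e v <= d e u.
Proof.
move=> s0 st; have [u] := EVT_max st (continuous_subspaceT (@arm_cont e)).
rewrite in_itv /= => ut hu; exists u => // v vt.
have u0 : 0 <= u by case/andP: ut => su _; exact: le_trans su.
have v0 : 0 <= v by case/andP: vt => sv _; exact: le_trans sv.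
by have := hu v; rewrite in_itv /= !S'E//; exact.
Qed.

Lemma arm_ivt e s t c : 0 <= s -> s <= t -> d e s <= c <= d e t ->
  exists2 u, s <= u <= t & d e u = c.
Proof.
move=> s0 st /andP[sc ct].
have [] := @IVT _ (fun t => arm_coord O e (S' t)) s t c st.
- exact/continuous_subspaceT/arm_cont.
- rewrite !S'E//; last exact: le_trans st.
  by rewrite -/(d e s) -/(d e t) ge_min sc le_max ct orbT.
move=> u; rewrite in_itv /= => ut; rewrite S'E => [uE|]; first by exists u.
by case/andP: ut => su _; exact: le_trans su.
Qed.

Definition visited t x := exists2 u, 0 <= u <= t & S u = x.

(** The distance to [x] is continuous in time, so it attains its infimum over
    [0, t]. *)
Lemma visited_closed t x : 0 <= t ->
  (forall eps, 0 < eps -> exists2 u, 0 <= u <= t & dist x (S u) < eps) ->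
  visited t x.
Proof.
move=> t0 h; have [u] := EVT_min t0 (continuous_subspaceT (@dist_cont x)).
rewrite in_itv /= => ut hu; exists u => //; apply/esym/dist_eq0/eqP.
rewrite eq_le dist_ge0 andbT leNgt; apply/negP => /h[v vt].
have := hu v; rewrite in_itv /= => /(_ vt).
rewrite !S'E; [|by case/andP: vt|by case/andP: ut].
by move=> /le_lt_trans l /l; rewrite ltxx.
Qed.

Definition reach e t := sup [set arm_coord O e (S u) | u in `[0, t]].

Let reach_has_sup e t : 0 <= t -> has_sup [set arm_coord O e (S u) | u in `[0, t]].
Proof.
move=> t0; split; first by exists (arm_coord O e (S 0)), 0; rewrite //= in_itv /= lexx.
by exists (arm_len O e) => _ [u _ <-]; exact: arm_coord_le.
Qed.

Lemma reach_ub e t u : 0 <= u <= t -> d e u <= reach e t.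
Proof.
move=> ut; apply: ub_le_sup; last by exists u; rewrite //= in_itv.
by exists (arm_len O e) => _ [v _ <-]; exact: arm_coord_le.
Qed.

Lemma reachP e t : 0 <= t -> exists2 u, 0 <= u <= t & d e u = reach e t.
Proof.
move=> t0; have [u ut hu] := arm_argmax e (lexx 0) t0; exists u => //.
apply/eqP; rewrite eq_le reach_ub//=; apply: ge_sup.
  by case: (reach_has_sup e t0).
by move=> _ [v + <-]; rewrite /= in_itv => /hu.
Qed.

Lemma reach_ge0 e t : 0 <= t -> 0 <= reach e t.
Proof. by move=> /(reachP e)[u _ <-]; exact: arm_coord_ge0. Qed.

Lemma reach_le_len e t : 0 <= t -> reach e t <= arm_len O e.
Proof. by move=> /(reachP e)[u _ <-]; exact: arm_coord_le. Qed.

Lemma reach_le e t c : 0 <= t -> (forall u, 0 <= u <= t -> d e u <= c) ->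
  reach e t <= c.
Proof. by move=> /(reachP e)[u ut <-]; exact. Qed.

Lemma reach_mono e s t : 0 <= s -> s <= t -> reach e s <= reach e t.
Proof.
move=> s0 st; apply: reach_le => // u /andP[u0 us]; apply: reach_ub.
by rewrite u0 (le_trans us).
Qed.

Lemma reach_self e t : 0 <= t -> d e t <= reach e t.
Proof. by move=> t0; apply: reach_ub; rewrite t0 lexx. Qed.

Lemma reach_lip e s t : 0 <= s -> s <= t -> reach e t <= reach e s + (t - s).
Proof.
move=> s0 st; apply: reach_le => [|u /andP[u0 ut]]; first exact: le_trans st.
case: (leP u s) => us.
  by have := @reach_ub e s u; rewrite u0 us => /(_ isT); lra.
have := search_lip s0 (ltW us); have := arm_lipschitz O e (S s) (S u).
have := reach_self e s0; rewrite ler_norml => h /andP[h1 h2] h3.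
by rewrite /d in h *; lra.
Qed.

Lemma reach0 e : reach e 0 = 0.
Proof.
have [u] := reachP e (lexx 0); rewrite -eq_le => /eqP <- <-.
by rewrite /d S0 arm_coord_root.
Qed.

Lemma reach_visited e t x : visited t x -> arm_coord O e x <= reach e t.
Proof. by move=> [u ut <-]; exact: reach_ub. Qed.

(** Interior points of the arm are visited by the intermediate value theorem.
    The far end is not determined by its projection on the arm, which is also
    that of all the points beyond it, and is reached as a limit. *)
Lemma visited_arm e t c : 0 <= t -> 0 < c <= reach e t ->
  visited t (arm_point O e c).
Proof.
move=> t0; have small c' : 0 < c' <= reach e t -> c' < arm_len O e ->
    visited t (arm_point O e c').
  move=> /andP[c0 cr] cl; have [v /andP[v0 vt] vE] := reachP e t0.
  have [|u /andP[u0 uv] uE] := @arm_ivt e 0 v c' (lexx 0) v0.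
    by rewrite {1}/d S0 arm_coord_root (ltW c0) vE.
  exists u; first by rewrite u0 (le_trans uv).
  by rewrite -uE arm_pointK// -/(d e u) uE c0.
move=> /andP[c0 cr]; have cl := le_trans cr (reach_le_len e t0).
apply: visited_closed => // eps eps0.
pose c' := Num.max (c - eps / 2) (c / 2).
have c'0 : 0 < c' by rewrite lt_max [X in _ || X]divr_gt0 ?orbT.
have c'c : c' < c by rewrite gt_max; apply/andP; split; lra.
have [||u ut uE] := small c'; first by rewrite c'0; lra.
  exact: lt_le_trans cl.
exists u => //; rewrite uE dist_arm_point ?(ltW c0) ?(ltW c'0)//=; last first.
  by rewrite (le_trans (ltW c'c)).
rewrite gtr0_norm ?subr_gt0//.
have : c - eps / 2 <= c' by rewrite le_max lexx.
lra.
Qed.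

Lemma visited_all t : 0 <= t -> (forall e, reach e t = arm_len O e) ->
  forall x, visited t x.
Proof.
move=> t0 h x; case: (eqVneq x O) => [->|/eqP /arm_point_surj[e [c [cl <-]]]].
  by exists 0; rewrite ?lexx.
by apply: visited_arm; rewrite ?h.
Qed.

(** Cutting the time interval at all the [v e] and using the l^1 embedding,
    the excursions on the various arms are paid for separately. *)
Lemma arm_variation (v : arc Q * bool -> R) s t : 0 <= s -> s <= t ->
  (forall e, s <= v e <= t) ->
  \sum_e (`|d e (v e) - d e s| + `|d e t - d e (v e)|) <= t - s.
Proof.
move=> s0 st hv; pose l := sort <=%R (map v (enum [set: arc Q * bool]%SET)).
have mem_l u : u \in l -> s <= u <= t.
  by rewrite mem_sort => /mapP[e _ ->].
have lt_ : last s (rcons l t) = t by rewrite last_rcons.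
have pl : path <=%R s (rcons l t).
  rewrite rcons_path path_min_sorted ?(sort_sorted le_total)//=; last first.
    by apply/allP => u /mem_l/andP[].
  have := mem_last s l; rewrite inE => /predU1P[->//|/mem_l/andP[]//].
have cost l' r : 0 <= r -> path <=%R r l' ->
    \sum_e path_variation (d e) r l' <= last r l' - r.
  elim: l' r => [|u l' IH] r r0 /=; first by rewrite subrr big1.
  move=> /andP[ru pu]; rewrite big_split /=.
  have := IH u (le_trans r0 ru) pu; have := search_lip r0 ru.
  rewrite (arm_distE O) => h1 h2.
  under eq_bigr do rewrite distrC.
  lra.
have := cost (rcons l t) s s0 pl; rewrite lt_; apply: le_trans.
apply: ler_sum => e _; have := @path_variation_ge2 _ (d e) s (rcons l t) (v e).
rewrite lt_; apply; rewrite mem_rcons inE mem_sort map_f ?orbT//.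
by rewrite mem_enum inE.
Qed.

(** Without waste, every visited point has been crossed once on the way out
    and, unless it lies between the root and the present position, once on the
    way back; the slack is the time spent in excess of that. *)
Definition slack t := t + dist O (S t) - 2 * \sum_e reach e t.

(** On an arm whose coordinate is [d] at time [s] and has maximum [m] over the
    interval, going up to [m] and then to the final position takes at least
    [2 m] minus both end values. Comparing with the new part of the arm, what
    is left is twice the height climbed below the previous record. *)
Lemma slack_climb e u s t : 0 <= s -> s <= u <= t ->
  slack s + 2 * Num.min (d e u - d e s) (reach e s - d e s) <= slack t.
Proof.
move=> s0 /andP[su ut]; have st := le_trans su ut; have t0 := le_trans s0 st.
have /choice[v hv] : forall e', exists v, s <= v <= t /\
    forall r, s <= r <= t -> d e' r <= d e' v.
  by move=> e'; have [v] := arm_argmax e' s0 st; exists v.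
have := @arm_variation v s t s0 st (fun e' => (hv e').1).
(* The growth of the slack due to the arm [e'], when the travel time is replaced
   by its lower bound in [arm_variation]. *)
pose T e' := `|d e' (v e') - d e' s| + `|d e' t - d e' (v e')|
  + (d e' t - d e' s) - 2 * (reach e' t - reach e' s).
have ds e' : d e' s <= d e' (v e') by apply: (hv e').2; rewrite lexx.
have dt e' : d e' t <= d e' (v e') by apply: (hv e').2; rewrite st lexx.
have TE e' : T e' = 2 * (d e' (v e') - d e' s) - 2 * (reach e' t - reach e' s).
  by rewrite /T ger0_norm ?subr_ge0// ler0_norm ?subr_le0//; lra.
have Tmin e' : 2 * Num.min (d e' (v e') - d e' s) (reach e' s - d e' s) <= T e'.
  have : reach e' t <= Num.max (reach e' s) (d e' (v e')).
    apply: reach_le => // r /andP[r0 rt]; rewrite le_max; case: (leP r s) => rs.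
      by rewrite reach_ub// r0.
    by rewrite (hv e').2 ?orbT// (ltW rs).
  rewrite TE; have := reach_self e' s0; have := ds e'.
  by case: (leP (reach e' s)); case: (leP (d e' (v e') - d e' s)); lra.
have T0 e' : 0 <= T e'.
  apply: le_trans (Tmin e'); rewrite mulr_ge0// le_min !subr_ge0 ds.
  exact: reach_self.
have : 2 * Num.min (d e u - d e s) (reach e s - d e s) <= \sum_e' T e'.
  rewrite (bigD1 e)//= (le_trans _ (lerD (Tmin e) (sumr_ge0 _ (fun e' _ => T0 e'))))//.
  rewrite addr0 ler_pM2l// le_min !ge_min lexx orbT andbT.
  by rewrite lerD2r (hv e).2 ?su.
rewrite /T sumrB big_split /= sumrB -mulr_sumr sumrB /slack !(dist_root O).
move: (\sum_e' (_ + _)) (\sum_e' reach e' s) (\sum_e' reach e' t) => A B C.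
rewrite -/(d e u) -/(d e s); move: (Num.min _ _) => m.
rewrite /d; move: (\sum_e _) (\sum_e _) => D E; lra.
Qed.

Lemma slack_mono s t : 0 <= s -> s <= t -> slack s <= slack t.
Proof.
move=> s0 st; have := arc_nonempty Q; case/card_gt0P => a _.
have := @slack_climb (a, true) s s t s0; rewrite lexx st => /(_ isT).
by rewrite subrr min_l ?mulr0 ?addr0// subr_ge0 reach_self.
Qed.

Lemma slack0 : slack 0 = 0.
Proof.
rewrite /slack S0 dist_refl addr0 big1 ?mulr0 ?subr0// => e _; exact: reach0.
Qed.

Lemma slack_ge0 t : 0 <= t -> 0 <= slack t.
Proof. by move=> t0; rewrite -slack0 slack_mono. Qed.

(** Without waste, once below its record an arm coordinate only decreases. *)
Lemma no_climb e s u t : 0 <= s -> s <= u <= t -> slack t <= slack s ->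
  d e s < reach e s -> d e u <= d e s.
Proof.
move=> s0 sut st ds; rewrite leNgt; apply/negP => du.
have := slack_climb e s0 sut.
have : 0 < Num.min (d e u - d e s) (reach e s - d e s) by rewrite lt_min !subr_gt0 du.
lra.
Qed.

End LipschitzSearch.

(** * Comparing two independent points *)

Section Ranks.
Local Open Scope classical_set_scope.
Local Open Scope ereal_scope.
Context d (T : measurableType d) (R : realType) (P : probability T R).
Variables (f : T -> \bar R) (mf : measurable_fun setT f).

Definition rank x := P [set y | f y <= f x].

Let mf1 : measurable_fun setT (fun z : T * T => f z.1).
Proof. exact: measurableT_comp. Qed.

Let mf2 : measurable_fun setT (fun z : T * T => f z.2).
Proof. exact: measurableT_comp. Qed.

Let A := [set z : T * T | f z.2 <= f z.1].

Let mA : measurable A.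
Proof. by have := measurable_lee measurableT mf2 mf1; rewrite setTI. Qed.

Let xA x : xsection A x = [set y | f y <= f x].
Proof. by apply/seteqP; split=> y; rewrite /xsection /= inE. Qed.

Let yA x : ysection A x = [set y | f x <= f y].
Proof. by apply/seteqP; split=> y; rewrite /ysection /= inE. Qed.

Lemma measurable_rank : measurable_fun setT rank.
Proof.
rewrite (_ : rank = P \o xsection A); first exact: measurable_fun_xsection.
by apply/funext => x; rewrite /rank /= xA.
Qed.

Lemma rank_ge0 x : 0 <= rank x.
Proof. exact: measure_ge0. Qed.

(** The events [f y <= f x] and [f x <= f y] for independent [x] and [y] have
    the same probability by Fubini's theorem; they cover everything and overlap
    when there is a tie. *)
Lemma integral_rank :
  \int[P]_x rank x + \int[P]_x rank x = 1 + \int[P]_x P [set y | f y = f x].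
Proof.
have mle x : measurable [set y | f y <= f x].
  by rewrite -xA; exact: measurable_xsection.
have mge x : measurable [set y | f x <= f y].
  by rewrite -yA; exact: measurable_ysection.
have meq : measurable_fun setT (fun x => P [set y | f y = f x]).
  have mB : measurable [set z : T * T | f z.2 = f z.1].
    by have := measurable_eqe measurableT mf2 mf1; rewrite setTI.
  rewrite (_ : (fun _ => _) = P \o xsection [set z : T * T | f z.2 = f z.1]).
    exact: measurable_fun_xsection.
  apply/funext => x /=; congr (P _); apply/seteqP.
  by split=> y; rewrite /xsection /= inE.
have sym : \int[P]_x rank x = \int[P]_x P [set y | f x <= f y].
  have := indic_fubini_tonelli P P mA.
  rewrite indic_fubini_tonelli_FE// indic_fubini_tonelli_GE// => h.
  rewrite -[LHS]/(\int[P]_x P [set y | f y <= f x]).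
  under eq_integral do rewrite -xA.
  by rewrite [LHS]h; apply: eq_integral => x _ /=; rewrite yA.
have mr' : measurable_fun setT (fun x => P [set y | f x <= f y]).
  rewrite (_ : (fun _ => _) = P \o ysection A); first exact: measurable_fun_ysection.
  by apply/funext => x /=; rewrite yA.
rewrite {2}sym -ge0_integralD//; [|exact: measurable_rank].
have <- : \int[P]_(x in setT) (cst 1 x) = 1 :> \bar R.
  by rewrite integral_cst// mul1e; exact: probability_setT.
rewrite -ge0_integralD//; apply: eq_integral => x _.
have -> : rank x + P [set y | f x <= f y] =
    P [set y | f y <= f x] + (P [set y | f x < f y] + P [set y | f y = f x]).
  congr (_ + _); rewrite -measureU//.
  - congr (P _); apply/seteqP; split=> y /=; rewrite le_eqVlt.
      by move=> /predU1P[->|]; [right|left].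
    by move=> [->|->]; rewrite ?eqxx ?orbT.
  - by rewrite -[X in measurable X]setTI; exact: measurable_lte.
  - by rewrite -[X in measurable X]setTI; exact: measurable_eqe.
  - by apply/seteqP; split=> // y /= [+ yx]; rewrite yx ltxx.
rewrite addeA -measureU//.
- rewrite (_ : _ `|` _ = setT); first by congr (_ + _); exact: probability_setT.
  by apply/seteqP; split=> // y _ /=; case: (leP (f y) (f x)); [left|right].
- by rewrite -[X in measurable X]setTI; exact: measurable_lte.
- by apply/seteqP; split=> // y /= [+ yx]; rewrite leNgt yx.
Qed.

End Ranks.

Section EqualIntegrals.
Local Open Scope classical_set_scope.
Local Open Scope ereal_scope.
Context d (T : measurableType d) (R : realType) (P : probability T R).

Lemma ae_eq_of_le_integral (f g : T -> \bar R) :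
  measurable_fun setT f -> measurable_fun setT g ->
  (forall x, f x \is a fin_num) -> (forall x, 0 <= f x <= g x) ->
  \int[P]_x f x < +oo -> \int[P]_x g x <= \int[P]_x f x ->
  {ae P, forall x, g x = f x}.
Proof.
move=> mf mg ff fg foo gf.
have mh : measurable_fun setT (fun x => g x - f x) by exact: emeasurable_funB.
have h0 x : 0 <= g x - f x by rewrite sube_ge0 ?ff//; case/andP: (fg x).
have gE : \int[P]_x g x = \int[P]_x f x + \int[P]_x (g x - f x).
  rewrite -ge0_integralD//; last by move=> x _; case/andP: (fg x).
  by apply: eq_integral => x _; rewrite addeC subeK.
have f0 : 0 <= \int[P]_x f x by apply: integral_ge0 => x _; case/andP: (fg x).
have : \int[P]_x `|g x - f x| = 0.
  under eq_integral do rewrite gee0_abs//.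
  apply/eqP; rewrite eq_le integral_ge0// andbT.
  by move: gf; rewrite gE -[leRHS]adde0 leeD2lE// ge0_fin_numE.
move/(ae_eq_integral_abs P measurableT mh).
apply: filterS => x /(_ Logic.I) /= h.
by rewrite -[LHS](subeK _ (ff x)) h add0e.
Qed.

End EqualIntegrals.

(** * Expected search time and slack *)

Section TreeMeasure.
Local Open Scope classical_set_scope.
Context {R : realType} (Q : tree_network R).
Implicit Types (a : arc Q) (x : tree_point Q).

Lemma measurable_dist_open (U : set (tree_point Q)) : dist_open U -> measurable U.
Proof. by move=> oU; exact: sub_sigma_algebra. Qed.

Lemma measurable_dist x : measurable_fun setT (fun y => (dist x y)%:E).
Proof.
apply/measurable_EFinP/(measurability _ (RGenOInfty.measurableE R)) => //.
move=> _ [_ [c ->] <-]; rewrite setTI; apply: measurable_dist_open => y /=.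
rewrite in_itv /= andbT => cy; exists (dist x y - c); first by rewrite subr_gt0.
move=> z yz; rewrite /= in_itv /= andbT.
have := dist_triangle x z y; rewrite (dist_sym z); lra.
Qed.

Lemma measurable_arc_preimage a (A : set (tree_point Q)) : measurable A ->
  measurable (arc_point a @^-1` A `&` `]0, len a[).
Proof.
move=> mA; apply: measurableI; last exact: measurable_itv.
by rewrite -[X in measurable X]setTI; exact: measurable_arc_point.
Qed.

Lemma measurable_tree_set1 x : measurable [set x].
Proof.
rewrite -[X in measurable X]setCK; apply: measurableC; apply: measurable_dist_open.
move=> y /= yx; exists (dist y x); last by move=> z + zx; rewrite zx ltxx.
rewrite lt_neqAle dist_ge0 andbT; apply/eqP => /esym/dist_eq0; exact: yx.
Qed.

Lemma length_measure_set1 x : length_measure [set x] = 0%E.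
Proof.
rewrite /length_measure big1// => a _; rewrite /arc_measure /pushforward /mrestr.
apply/eqP; rewrite -measure_le0 -(@lebesgue_measure_set1 R (coord a x)).
apply: le_measure; rewrite ?inE //.
  apply: measurable_arc_preimage; exact: measurable_tree_set1.
move=> c /= [<-]; rewrite in_itv /= => /andP[c0 cl].
by rewrite coord_arc_point ?eqxx// (ltW c0) (ltW cl).
Qed.

Lemma uniform_lawE (A : set (tree_point Q)) :
  uniform_law Q A = ((total_length Q)^-1%:E * length_measure A)%E.
Proof. by []. Qed.

Lemma dist_le_length (x y : tree_point Q) : dist x y <= total_length Q.
Proof.
rewrite -(sum_arm_len x) dist_root; apply: ler_sum => e _; exact: arm_coord_le.
Qed.

Lemma mean_dist_ge0 x : (0 <= mean_dist x)%E.
Proof. by apply: integral_ge0 => y _; rewrite lee_fin dist_ge0. Qed.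

Lemma mean_dist_fin x : mean_dist x \is a fin_num.
Proof.
rewrite ge0_fin_numE ?mean_dist_ge0//.
apply: (@le_lt_trans _ _ (\int[uniform_law Q]_y (total_length Q)%:E)%E).
  apply: ge0_le_integral => //.
  - by move=> y _; rewrite lee_fin dist_ge0.
  - exact: measurable_dist.
  - by move=> y _; rewrite lee_fin dist_le_length.
rewrite integral_cst//= probability_setT mule1 ltry//.
Qed.

End TreeMeasure.

Section SearchTimes.
Local Open Scope classical_set_scope.
Context {R : realType} (Q : tree_network R) (O : tree_point Q).
Variable S : R -> tree_point Q.
Hypothesis S0 : S 0 = O.
Hypothesis Slip : forall t1 t2, 0 <= t1 -> t1 < t2 ->
  dist (S t1) (S t2) <= t2 - t1.
Implicit Types (e : arc Q * bool) (x : tree_point Q) (s t u c : R).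

Let T := search_time S.
Let mu := total_length Q.

Lemma search_time_ge0 x : (0 <= T x)%E.
Proof. by apply: le_ereal_inf_tmp => _ [t [t0 _] <-]; rewrite lee_fin. Qed.

(** The infimum defining the search time is attained because the set of
    visited points is closed. *)
Lemma search_time_le t x : 0 <= t -> (T x <= t%:E)%E <-> visited S t x.
Proof.
move=> t0; split=> [Tt|[u /andP[u0 ut] ux]]; last first.
  apply: (@le_trans _ _ u%:E); last by rewrite lee_fin.
  by apply: ereal_inf_lbound; exists u.
apply: (visited_closed Slip) => // eps e0.
have : (T x < (t + eps)%:E)%E by rewrite (le_lt_trans Tt)// lte_fin ltrDl.
move/ereal_inf_lt => [_ [u [u0 ux] <-]]; rewrite lte_fin => ute.
case: (leP u t) => ut; first by exists u; rewrite ?u0// -ux dist_refl.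
exists t; rewrite ?t0 ?lexx// -ux dist_sym (le_lt_trans (Slip t0 ut))//; lra.
Qed.

Lemma search_time_fin t x : T x = t%:E -> 0 <= t /\ S t = x.
Proof.
move=> Tt; have t0 : 0 <= t by rewrite -lee_fin -Tt search_time_ge0.
split=> //; have [|u /andP[u0 ut] ux] := (search_time_le x t0).1.
  by rewrite Tt.
suff -> : t = u by [].
apply/eqP; rewrite eq_le ut andbT -lee_fin -Tt.
by apply/search_time_le => //; exists u; rewrite ?u0 ?lexx.
Qed.

Lemma visitedE t : 0 <= t -> [set x | visited S t x] = [set x | (T x <= t%:E)%E].
Proof.
move=> t0; apply/seteqP; split=> x /= h; first exact/(search_time_le x t0).
exact/(search_time_le x t0).
Qed.

Lemma measurable_visited t : 0 <= t -> measurable [set x | visited S t x].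
Proof.
move=> t0; rewrite -[X in measurable X]setCK; apply: measurableC.
apply: measurable_dist_open => x /= nx; apply: contrapT => h; apply: nx.
apply: (visited_closed Slip) => // eps eps0.
apply: contrapT => h'; apply: h; exists eps => // y xy [u ut uy]; apply: h'.
by exists u; rewrite ?uy.
Qed.

Lemma measurable_search_time : measurable_fun setT T.
Proof.
apply: (measurability _ (ErealGenOInfty.measurableE R)) => // _ [_ [t ->] <-].
rewrite setTI; case: (leP 0 t) => t0; last first.
  rewrite (_ : _ @^-1` _ = setT)//; apply/seteqP; split=> // x _ /=.
  by rewrite in_itv /= andbT (lt_le_trans _ (search_time_ge0 x)) ?lte_fin.
rewrite (_ : _ @^-1` _ = ~` [set x | visited S t x]).
  by apply: measurableC; exact: measurable_visited.
rewrite visitedE//; apply/seteqP; split=> x /=; rewrite in_itv /= andbT ltNge.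
  by move/negP.
by move/negP.
Qed.

Lemma arc_measure_visited a t : 0 <= t ->
  arc_measure a [set x | visited S t x] =
  (reach O S (a, true) t + reach O S (a, false) t)%:E.
Proof.
move=> t0; rewrite /arc_measure /pushforward /mrestr.
set B := _ `&` _; set M := reach O S (a, true) t; set m := reach O S (a, false) t.
pose p := coord a O; have M0 : 0 <= M by exact: (reach_ge0 O Slip).
have m0 : 0 <= m by exact: (reach_ge0 O Slip).
have Ml : M <= len a - p by exact: (reach_le_len O Slip (a, true)).
have ml : m <= p by exact: (reach_le_len O Slip (a, false)).
have mB : measurable B by apply: measurable_arc_preimage; exact: measurable_visited.
have len_itv b b' : lebesgue_measure [set` Interval (BSide b (p - m))
    (BSide b' (p + M))] = (M + m)%:E :> \bar R.
  rewrite lebesgue_measure_itv /= lte_fin; case: ltP => h.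
    by rewrite -EFinB; congr EFin; lra.
  by congr EFin; lra.
apply/eqP; rewrite eq_le; apply/andP; split.
  rewrite -(len_itv true false); apply: le_measure; rewrite ?inE//.
  move=> c [/= cv]; rewrite !in_itv /= => /andP[c0 cl].
  have cc : coord a (arc_point a c) = c.
    by rewrite coord_arc_point ?eqxx// (ltW c0) (ltW cl).
  have := reach_visited O (a, true) cv; have := reach_visited O (a, false) cv.
  rewrite /arm_coord /= cc !ge_max -/p -/M -/m => /andP[_ h1] /andP[_ h2].
  by apply/andP; split; lra.
rewrite -(len_itv false true); apply: le_measure; rewrite ?inE//.
move=> c /=; rewrite in_itv /= => /andP[h1 h2].
have cl : 0 < c < len a by apply/andP; split; lra.
split; last by rewrite /= in_itv.
rewrite /=; case: (ltgtP c p) => cp.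
- rewrite (_ : arc_point a c = arm_point O (a, false) (p - c)); last first.
    by rewrite /arm_point /= -/p subKr.
  by apply: (visited_arm S0 Slip) => //; rewrite -/m; apply/andP; split; lra.
- rewrite (_ : arc_point a c = arm_point O (a, true) (c - p)); last first.
    by rewrite /arm_point /= -/p subrKC.
  by apply: (visited_arm S0 Slip) => //; rewrite -/M; apply/andP; split; lra.
by exists 0; rewrite ?lexx// S0 cp /p coordK// -/p -cp.
Qed.

(** On each arc the visited part is, up to its two ends, the interval between
    the farthest points reached on both arms. *)
Lemma length_visited t : 0 <= t ->
  length_measure [set x | visited S t x] = (\sum_e reach O S e t)%:E.
Proof.
move=> t0; rewrite sum_arms -sumEFin /length_measure.
by apply: eq_bigr => a _; rewrite arc_measure_visited.
Qed.

Let rk := rank (uniform_law Q) T.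

Let mu0 : 0 < mu := total_length_gt0 Q.

Let rkE x : rk x = (mu^-1%:E * length_measure [set y | (T y <= T x)%E])%E.
Proof. by []. Qed.

(** At the time when [x] is discovered, the points visited are those that are
    discovered no later than [x]. *)
Lemma slack_rank t x : T x = t%:E ->
  (T x + (dist O x)%:E = (slack O S t)%:E + (2 * mu)%:E * rk x)%E.
Proof.
move=> Tt; have [t0 tx] := search_time_fin Tt.
rewrite rkE Tt -visitedE// length_visited// -!EFinM -!EFinD.
by congr EFin; rewrite /slack tx -!mulrA mulVKf ?gt_eqF//; lra.
Qed.

Lemma rank_le_search_time x : ((2 * mu)%:E * rk x <= T x + (dist O x)%:E)%E.
Proof.
case E : (T x) (search_time_ge0 x) => [t| |] // _.
  rewrite -E (slack_rank E) leeDr// lee_fin (slack_ge0 S0 Slip)//.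
  by have [] := search_time_fin E.
by rewrite addye ?leey.
Qed.

Let mrk : measurable_fun setT rk.
Proof. by apply: measurable_rank; exact: measurable_search_time. Qed.

Let int_sum : (\int[uniform_law Q]_x (T x + (dist O x)%:E) =
  expected_time S (uniform_law Q) + mean_dist O)%E.
Proof.
rewrite ge0_integralD//.
- by move=> x _; exact: search_time_ge0.
- exact: measurable_search_time.
- by move=> x _; rewrite lee_fin dist_ge0.
- exact: measurable_dist.
Qed.

Let int_rank : (\int[uniform_law Q]_x ((2 * mu)%:E * rk x) =
  mu%:E * (1 + \int[uniform_law Q]_x uniform_law Q [set y | T y = T x]))%E.
Proof.
have [I E I0] : exists2 I,
    (\int[uniform_law Q]_x rk x)%E = I & (0 <= I)%E.
  by eexists; [reflexivity|apply: integral_ge0 => x _; exact: rank_ge0].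
rewrite ge0_integralZl//; last by rewrite lee_fin mulr_ge0// ltW.
rewrite -integral_rank; last exact: measurable_search_time.
rewrite -/rk E mulr_natl mulr2n EFinD ge0_muleDl ?lee_fin ?(ltW mu0)//.
by rewrite ge0_muleDr.
Qed.

(** Averaging [rank_le_search_time] over [x]: the rank has mean at least 1/2. *)
Lemma expected_time_ge :
  (mu%:E - mean_dist O <= expected_time S (uniform_law Q))%E.
Proof.
rewrite leeBlDr ?mean_dist_fin// -int_sum.
apply: (@le_trans _ _ (\int[uniform_law Q]_x ((2 * mu)%:E * rk x))%E).
  rewrite int_rank -[leLHS]mule1 lee_pmul2l ?lte_fin//.
  by rewrite leeDl// integral_ge0.
apply: ge0_le_integral => //.
- by move=> x _; rewrite mule_ge0 ?rank_ge0// lee_fin mulr_ge0// ltW.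
- exact: measurable_funeM.
- by apply: emeasurable_funD; [exact: measurable_search_time|exact: measurable_dist].
- by move=> x _; exact: rank_le_search_time.
Qed.

(** There are no ties: at a finite time only one point can be discovered. *)
Lemma expected_time_tight :
  (forall x, exists2 t, T x = t%:E & slack O S t <= 0) ->
  (expected_time S (uniform_law Q) = mu%:E - mean_dist O)%E.
Proof.
move=> h; have tight x : (T x + (dist O x)%:E = (2 * mu)%:E * rk x)%E.
  have [t Tt st] := h x; have [t0 _] := search_time_fin Tt.
  rewrite (slack_rank Tt) (_ : slack O S t = 0) ?add0e//.
  by apply/eqP; rewrite eq_le st (slack_ge0 S0 Slip).
apply/esym/eqP; rewrite sube_eq ?fin_num_adde_defl ?mean_dist_fin//.
rewrite -int_sum; under eq_integral do rewrite tight.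
rewrite int_rank integral0_eq ?adde0 ?mule1// => x _.
have [t Tt _] := h x; apply/eqP; rewrite -measure_le0.
have <- : uniform_law Q [set S t] = 0%E.
  by rewrite uniform_lawE length_measure_set1 mule0.
have [t0 _] := search_time_fin Tt.
apply: le_measure; rewrite ?inE//.
- by rewrite -[X in measurable X]setTI Tt; exact: measurable_eqe measurable_search_time _.
- exact: measurable_tree_set1.
by move=> y /=; rewrite Tt => /search_time_fin[_ <-].
Qed.

(** If the bound is attained, then almost every point is discovered without
    slack; as the slack never decreases, almost every point has been discovered
    by any time of positive slack, and then every point, by closedness. *)
Lemma optimal_no_slack t :
  (expected_time S (uniform_law Q) <= mu%:E - mean_dist O)%E ->
  0 <= t -> 0 < slack O S t -> forall x, visited S t x.
Proof.
move=> opt t0 st; suff lt_ : length_measure [set x | visited S t x] = mu%:E.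
  apply: (visited_all S0 Slip) => // e; apply/eqP; move: lt_.
  rewrite length_visited// => -[]; rewrite /mu -(sum_arm_len O) => /eqP.
  rewrite eq_sym -subr_eq0 -sumrB psumr_eq0; last first.
    by move=> e' _; rewrite subr_ge0 (reach_le_len O Slip).
  by move=> /allP/(_ e); rewrite mem_index_enum subr_eq0 eq_sym => /(_ isT).
have rk1 x : (rk x <= 1)%E.
  apply: probability_le1; rewrite -[X in measurable X]setTI.
  by apply: measurable_lee => //; exact: measurable_search_time.
have rk_fin x : ((2 * mu)%:E * rk x)%E \is a fin_num.
  by rewrite fin_numM// ge0_fin_numE ?rank_ge0// (le_lt_trans (rk1 x))// ltry.
have ae : {ae uniform_law Q, forall x,
    (T x + (dist O x)%:E = (2 * mu)%:E * rk x)%E}.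
  apply: ae_eq_of_le_integral => //.
  - exact: measurable_funeM.
  - by apply: emeasurable_funD; [exact: measurable_search_time|exact: measurable_dist].
  - move=> x; rewrite rank_le_search_time andbT mule_ge0 ?rank_ge0//.
    by rewrite lee_fin mulr_ge0// ltW.
  - apply: (@le_lt_trans _ _ (\int[uniform_law Q]_x (2 * mu)%:E)%E).
      apply: ge0_le_integral => //.
      + by move=> x _; rewrite mule_ge0 ?rank_ge0// lee_fin mulr_ge0// ltW.
      + exact: measurable_funeM.
      + move=> x _; rewrite -[leRHS]mule1 lee_pmul2l// lte_fin mulr_gt0//.
    by rewrite integral_cst//= probability_setT mule1 ltry.
  rewrite int_sum int_rank.
  apply: (@le_trans _ _ mu%:E); first by rewrite -leeBrDr ?mean_dist_fin.
  by rewrite -[leLHS]mule1 lee_pmul2l ?lte_fin// leeDl// integral_ge0.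
case: ae => N [mN N0 hN].
have u0 : length_measure (~` [set x | visited S t x]) = 0%E.
  have mv : measurable (~` [set x | visited S t x]).
    by apply: measurableC; exact: measurable_visited.
  have : uniform_law Q (~` [set x | visited S t x]) = 0%E.
    apply/eqP; rewrite -measure_le0 -N0; apply: le_measure; rewrite ?inE//.
    move=> x /= nx; apply: hN => /= tx; apply: nx; apply/search_time_le => //.
    have := rk_fin x; rewrite -tx fin_numD => /andP[/fineK Tx _].
    rewrite -Tx lee_fin leNgt; apply/negP => tr.
    have := slack_rank (esym Tx); rewrite tx.
    case: ((2 * mu)%:E * rk x)%E (rk_fin x) => // k _ [] h.
    have := slack_mono O Slip t0 (ltW tr); lra.
  rewrite uniform_lawE => /eqP; rewrite mule_eq0 eqe invr_eq0 gt_eqF//=.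
  by move=> /eqP.
rewrite -length_measureT -(setvU [set x | visited S t x]); apply/esym.
transitivity (length_measure (~` [set x | visited S t x]) +
  length_measure [set x | visited S t x])%E; last by rewrite u0 add0e.
apply: measureU; last exact: setICl.
  by apply: measurableC; exact: measurable_visited.
exact: measurable_visited.
Qed.

End SearchTimes.

(** * Moving at unit speed along a walk *)

Section NoSlackNormal.
Local Open Scope classical_set_scope.
Context {R : realType} (Q : tree_network R) (O : tree_point Q).
Implicit Types (e : arc Q * bool) (x y z : tree_point Q).

Lemma arm_coord_between e x y z : dist x z + dist z y = dist x y ->
  arm_coord O e z <= Num.max (arm_coord O e x) (arm_coord O e y).
Proof.
move=> h; pose f e := `|arm_coord O e x - arm_coord O e z| +
  `|arm_coord O e z - arm_coord O e y| - `|arm_coord O e x - arm_coord O e y|.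
have f0 e' : true -> 0 <= f e' by move=> _; rewrite /f subr_ge0 ler_distD.
have : \sum_e f e = 0.
  by rewrite sumrB big_split /= -!(arm_distE O) h subrr.
move/(psumr_eq0P f0)/(_ e isT); rewrite /f.
move: (arm_coord O e x) (arm_coord O e y) (arm_coord O e z) => p q r.
case: (leP p q) => pq; case: (leP p r) => pr; case: (leP r q) => rq; try lra.
all: by do ?[rewrite ler0_norm; last lra | rewrite ger0_norm; last lra]; lra.
Qed.

Variable S : R -> tree_point Q.
Hypothesis S0 : S 0 = O.
Hypothesis Slip : forall t1 t2, 0 <= t1 -> t1 < t2 ->
  dist (S t1) (S t2) <= t2 - t1.

(** During such a move the record of an arm grows by no more than the positive
    part of the variation of its coordinate, so zero slack forces the move to
    take no longer than the distance between its ends. *)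
Lemma no_slack_normal :
  (forall t, 0 <= t -> (t%:E <= cover_time S)%E -> slack O S t <= 0) ->
  normal S.
Proof.
move=> noslack t1 t2 t10 t12 t2c im.
have t20 : 0 <= t2 by rewrite ltW// (le_lt_trans t10).
have h1 := slack_ge0 S0 Slip t10; have h2 := noslack _ t20 t2c.
have reach2 e : reach O S e t2 <= Num.max (reach O S e t1) (arm_coord O e (S t2)).
  apply: (reach_le Slip) => // u /andP[u0 ut]; case: (leP u t1) => ut1.
    by rewrite le_max reach_ub// u0.
  have : tree_path (S t1) (S t2) (S u).
    by rewrite -im; exists u => //=; rewrite in_itv /= (ltW ut1).
  move=> /(arm_coord_between e) h; apply: (le_trans h).
  rewrite ge_max; apply/andP; split; rewrite le_max; last by rewrite lexx orbT.
  by rewrite reach_self.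
have : 2 * (\sum_e reach O S e t2 - \sum_e reach O S e t1) <=
    dist (S t1) (S t2) + (dist O (S t2) - dist O (S t1)).
  rewrite (arm_distE O) !(dist_root O) -!sumrB -big_split mulr_sumr /=.
  apply: ler_sum => e _; have := reach2 e; have := reach_self O S e t10.
  have := ler_norm (arm_coord O e (S t2) - arm_coord O e (S t1)).
  rewrite distrC; have := normr_ge0 (arm_coord O e (S t1) - arm_coord O e (S t2)).
  have := ler_norm (arm_coord O e (S t1) - arm_coord O e (S t2)).
  case: (leP (reach O S e t1)); lra.
have h3 := Slip t10 t12; move: h1 h2; rewrite /slack => h1 h2 h4.
have E : dist (S t1) (S t2) = t2 - t1 by lra.
move=> s /andP[s0 st].
have k1 := search_lip Slip t10 (_ : t1 <= t1 + s).
have k2 := search_lip Slip (_ : 0 <= t1 + s) (_ : t1 + s <= t2).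
have k3 := dist_triangle (S t1) (S (t1 + s)) (S t2).
have {}k1 : dist (S t1) (S (t1 + s)) <= t1 + s - t1 by apply: k1; lra.
have {}k2 : dist (S (t1 + s)) (S t2) <= t2 - (t1 + s) by apply: k2; lra.
by split; rewrite /tree_path /=; lra.
Qed.

End NoSlackNormal.

Section WalkSearch.
Context {R : realType} (Q : tree_network R).
Implicit Types (x y : tree_point Q) (l : leg Q) (w : seq (leg Q)) (s t : R).

Lemma leg_len_ge0 l : 0 <= leg_len l.
Proof. exact: normr_ge0. Qed.

Lemma leg_at0 l : leg_at l 0 = leg_start l.
Proof. by rewrite /leg_at mulr0 addr0. Qed.

Lemma leg_at_len l : leg_at l (leg_len l) = leg_end l.
Proof. by rewrite /leg_at /leg_len mulr_sg_norm subrKC. Qed.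

Lemma leg_at_lip l s t : s <= t -> dist (leg_at l s) (leg_at l t) <= t - s.
Proof.
move=> st; apply: (le_trans (dist_arc_point _ _ _)).
rewrite opprD addrACA subrr add0r -mulrN -mulrDr normrM distrC.
rewrite (@ger0_norm _ (t - s)) ?subr_ge0// normr_sg.
by case: eqP; rewrite ?mul0r ?mul1r ?subr_ge0.
Qed.

Definition walk_len w : R := \sum_(k <- w) leg_len k.

Lemma walk_len_ge0 w : 0 <= walk_len w.
Proof. by rewrite /walk_len sumr_ge0// => l _; exact: leg_len_ge0. Qed.

(** After the last leg the search rests, so that it is defined at all times. *)
Fixpoint walk_search x w t : tree_point Q :=
  if w is l :: w' then
    if t <= leg_len l then leg_at l t
    else walk_search (leg_end l) w' (t - leg_len l)
  else x.

Lemma walk_search0 x w y : leg_walk x w y -> walk_search x w 0 = x.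
Proof.
by case: w => [//|l w] /= /andP[/eqP <- _]; rewrite leg_len_ge0 leg_at0.
Qed.

Lemma walk_search_cons x l w y t : leg_walk x (l :: w) y -> 0 <= t ->
  walk_search x (l :: w) (leg_len l + t) = walk_search (leg_end l) w t.
Proof.
move=> /= /andP[_ lw]; rewrite le_eqVlt => /predU1P[<-|t0].
  by rewrite addr0 lexx leg_at_len (walk_search0 lw).
by rewrite gerDl leNgt t0 /= [_ + t]addrC addrK.
Qed.

Lemma walk_search_lip x w y s t : leg_walk x w y -> 0 <= s -> s <= t ->
  dist (walk_search x w s) (walk_search x w t) <= t - s.
Proof.
elim: w x s t => [|l w IH] x s t /=; first by rewrite dist_refl subr_ge0.
move=> /andP[_ lw] s0 st.
case: (leP s (leg_len l)) => sl; case: (leP t (leg_len l)) => tl.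
- exact: leg_at_lip.
- apply: (le_trans (dist_triangle _ (leg_end l) _)).
  have h1 := @leg_at_lip l s _ sl; rewrite leg_at_len in h1.
  have := IH _ 0 (t - leg_len l) lw (lexx _).
  rewrite (walk_search0 lw) subr_ge0 => /(_ (ltW tl)); lra.
- by move: (lt_le_trans sl st); rewrite ltNge tl.
have := IH _ (s - leg_len l) (t - leg_len l) lw.
by rewrite subr_ge0 lerD2r => /(_ (ltW sl) st); lra.
Qed.

Lemma walk_search_unit_speed x w y : leg_walk x w y ->
  unit_speed (walk_search x w) w.
Proof.
move=> lw w1 l w2; elim: w1 x w lw => [|k w1 IH] x w lw E s sl.
  by rewrite E big_nil add0r /=; case/andP: sl => _ ->.
move: lw; rewrite E cat_cons => lw; rewrite big_cons -addrA (walk_search_cons lw).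
  by case/andP: lw => _ lw; exact: (IH _ _ lw).
by case/andP: sl => s0 _; rewrite addr_ge0// walk_len_ge0.
Qed.

Lemma walk_search_split w t : w != [::] -> 0 <= t <= walk_len w ->
  exists w1 l w2 s, [/\ w = w1 ++ l :: w2, 0 <= s <= leg_len l
    & t = walk_len w1 + s].
Proof.
elim: w t => [//|l w IH] t _ /andP[t0]; rewrite /walk_len big_cons => tl.
case: (leP t (leg_len l)) => tl1.
  by exists [::], l, w, t; rewrite big_nil add0r t0.
have wn : w != [::] by apply/eqP => w0; move: tl; rewrite w0 big_nil; lra.
have [|w1 [k [w2 [s [-> sk E]]]]] := IH (t - leg_len l) wn.
  by apply/andP; split; rewrite /walk_len; lra.
exists (l :: w1), k, w2, s; split=> //; move: E.
by rewrite /walk_len big_cons; lra.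
Qed.

Lemma walk_len_cat w1 w2 : walk_len (w1 ++ w2) = walk_len w1 + walk_len w2.
Proof. by rewrite /walk_len big_cat. Qed.

Lemma leg_walk_cat x w1 w2 y : leg_walk x (w1 ++ w2) y ->
  exists2 z, leg_walk x w1 z & leg_walk z w2 y.
Proof.
elim: w1 x => [|l w1 IH] x /=; first by exists x.
by move=> /andP[-> /IH[z]]; exists z.
Qed.

Lemma leg_walk_trans x w1 z w2 y : leg_walk x w1 z -> leg_walk z w2 y ->
  leg_walk x (w1 ++ w2) y.
Proof.
elim: w1 x => [|l w1 IH] x /=; first by move/eqP ->.
by move=> /andP[-> h] /(IH _ h).
Qed.

Lemma unit_speed_start S w w1 l w2 : unit_speed S w -> w = w1 ++ l :: w2 ->
  S (walk_len w1) = leg_start l.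
Proof.
move=> us /us/(_ 0); rewrite lexx leg_len_ge0 addr0 => /(_ isT) ->.
exact: leg_at0.
Qed.

Lemma unit_speed_end S w w1 l w2 : unit_speed S w -> w = w1 ++ l :: w2 ->
  S (walk_len w1 + leg_len l) = leg_end l.
Proof.
move=> us /us/(_ (leg_len l)); rewrite lexx leg_len_ge0 => /(_ isT) ->.
exact: leg_at_len.
Qed.

End WalkSearch.

Section TourSlack.
Local Open Scope classical_set_scope.
Context {R : realType} (Q : tree_network R) (O : tree_point Q).
Implicit Types (e : arc Q * bool) (x y : tree_point Q) (w : seq (leg Q)).

(** An outward leg adds twice its length, an inward one nothing. *)
Lemma leg_walk_len w y : leg_walk O w y -> uniq w ->
  {subset w <= rooted_legs O} ->
  walk_len w + dist O y = 2 * \sum_(e | out O e \in w) arm_len O e.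
Proof.
elim/last_ind: w y => [|w l IH] y.
  rewrite /= => /eqP <- _ _; rewrite dist_refl /walk_len big_nil addr0.
  by rewrite big_pred0 ?mulr0.
rewrite -cats1 => /leg_walk_cat[z wz /= /andP[/eqP lz /eqP ly]].
rewrite cats1 rcons_uniq => /andP[lw uw] ws.
have ws' : {subset w <= rooted_legs O}.
  by move=> k kw; apply: ws; rewrite mem_rcons inE kw orbT.
have {}IH := IH z wz uw ws'.
rewrite -cats1 walk_len_cat {2}/walk_len big_seq1.
have /rooted_legsP[e l0 le] : l \in rooted_legs O.
  by apply: ws; rewrite mem_rcons inE eqxx.
have de := depth_arm_point (armlP O e).
case: le => le; rewrite le in lz ly lw *.
  rewrite (bigD1 e) /=; last by rewrite mem_cat inE eqxx orbT.
  rewrite (eq_bigl (fun e' => out O e' \in w)); last first.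
    move=> e'; rewrite mem_cat inE (inj_eq (@out_inj _ _ O)).
    by case: eqVneq => [->|]; rewrite ?(negPf lw) ?andbF ?orbF ?andbT.
  rewrite -ly -lz leg_len_out leg_end_out leg_start_out in IH *.
  by rewrite de; lra.
rewrite (eq_bigl (fun e' => out O e' \in w)); last first.
  by move=> e'; rewrite mem_cat inE (negPf (out_neq_inn _ l0)) orbF.
rewrite -ly -lz leg_len_inn leg_end_inn leg_start_inn in IH *.
by rewrite de in IH; lra.
Qed.

Variable S : R -> tree_point Q.
Hypothesis S0 : S 0 = O.
Hypothesis Slip : forall t1 t2, 0 <= t1 -> t1 < t2 ->
  dist (S t1) (S t2) <= t2 - t1.

(** Time plus depth is twice the length of the outward part of the walk, all
    of which has been visited. *)
Lemma unit_speed_slack w y t : unit_speed S w -> leg_walk O w y -> uniq w ->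
  {subset w <= rooted_legs O} -> 0 <= t <= walk_len w -> slack O S t <= 0.
Proof.
move=> us lw uw ws /andP[t0 tw].
case: (eqVneq w [::]) => [w0|wn].
  have -> : t = 0.
    by apply/eqP; rewrite eq_le t0 andbT; move: tw; rewrite w0 /walk_len big_nil.
  by rewrite (slack0 S0 Slip).
have [|w1 [l [w2 [s [E sl ts]]]]] := walk_search_split wn (t := t).
  by rewrite t0.
have St : S t = leg_at l s by rewrite ts (us _ _ _ E).
have := lw; rewrite E => /leg_walk_cat[z lw1 /= /andP[/eqP lz _]].
have uw1 : uniq w1 by move: uw; rewrite E cat_uniq => /andP[].
have ln : l \notin w1.
  move: uw; rewrite E cat_uniq => /and3P[_ /hasPn h _]; apply: (h l).
  by rewrite inE eqxx.
have ws1 : {subset w1 <= rooted_legs O}.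
  by move=> k kw; apply: ws; rewrite E mem_cat kw.
have L1 := leg_walk_len lw1 uw1 ws1.
have full e : out O e \in w1 -> arm_len O e <= reach O S e t.
  move=> ew; have [u1 [u2 E1]] : exists u1 u2, w1 = u1 ++ out O e :: u2.
    by case/splitPr: ew => u1 u2; exists u1, u2.
  have E2 : w = u1 ++ out O e :: (u2 ++ l :: w2).
    by rewrite E E1 -catA.
  have := unit_speed_end us E2; rewrite leg_len_out leg_end_out => Se.
  rewrite -[leLHS](arm_coordK (armlP O e)) -Se; apply: reach_ub.
  rewrite addr_ge0 ?arm_len_ge0 ?walk_len_ge0//= ts E1 walk_len_cat -addrA lerD2l.
  rewrite /walk_len big_cons leg_len_out -addrA lerDl addr_ge0 ?walk_len_ge0//.
  by case/andP: sl.
have reach0 e : 0 <= reach O S e t by exact: (reach_ge0 O Slip).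
have sum_ge (P : pred (arc Q * bool)) : (forall e, P e -> out O e \in w1) ->
    \sum_(e | P e) arm_len O e <= \sum_(e | P e) reach O S e t.
  by move=> h; apply: ler_sum => e /h; exact: full.
have /rooted_legsP[e l0 le] : l \in rooted_legs O.
  by apply: ws; rewrite E mem_cat inE eqxx orbT.
have := sum_ge [pred e | out O e \in w1] (fun e h => h).
have split P : \sum_e' reach O S e' t =
    \sum_(e' | P e') reach O S e' t + \sum_(e' | ~~ P e') reach O S e' t.
  by rewrite (bigID P).
rewrite /slack St (split [pred e | out O e \in w1]) /=.
case: le => le; rewrite le in St lz ln sl *.
  have sl' : 0 <= s <= arm_len O e by rewrite -(leg_len_out O).
  rewrite (leg_at_out _ l0) depth_arm_point// -leg_start_out lz.
  have : s <= \sum_(e' | out O e' \notin w1) reach O S e' t.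
    rewrite (bigD1 e)//=; have : s <= reach O S e t.
      rewrite -[leLHS](arm_coordK sl') -(leg_at_out _ l0) -St.
      exact: reach_self.
    have : 0 <= \sum_(e' | (out O e' \notin w1) && (e' != e)) reach O S e' t.
      by rewrite sumr_ge0.
    lra.
  move: L1; lra.
have sl' : 0 <= arm_len O e - s <= arm_len O e.
  by move: sl; rewrite leg_len_inn => /andP[? ?]; apply/andP; split; lra.
rewrite (leg_at_inn _ l0) depth_arm_point//.
have : dist O z = dist O (arm_point O e 0) + arm_len O e.
  by rewrite -lz leg_start_inn depth_arm_point ?armlP.
have : 0 <= \sum_(e' | out O e' \notin w1) reach O S e' t by rewrite sumr_ge0.
move: L1; lra.
Qed.

Lemma tour_visits w x : unit_speed S w -> perm_eq w (rooted_legs O) ->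
  visited S (walk_len w) x.
Proof.
move=> us pw; case: (eqVneq x O) => [->|/eqP /arm_point_surj].
  by exists 0; rewrite ?lexx ?walk_len_ge0.
move=> [e [c [/andP[c0 cl] <-]]].
have l0 : 0 < arm_len O e by exact: lt_le_trans cl.
have ew : out O e \in w.
  by rewrite (perm_mem pw); apply/rooted_legsP; exists e => //; left.
have [w1 [w2 E]] : exists w1 w2, w = w1 ++ out O e :: w2.
  by case/splitPr: ew => w1 w2; exists w1, w2.
exists (walk_len w1 + c).
  rewrite addr_ge0 ?walk_len_ge0 ?(ltW c0)//= E walk_len_cat lerD2l.
  rewrite /walk_len big_cons leg_len_out (le_trans cl)// lerDl.
  exact: walk_len_ge0.
by rewrite (us _ _ _ E) ?leg_at_out// (ltW c0) leg_len_out.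
Qed.

End TourSlack.

Lemma depth_first_expected_time (R : realType) (Q : tree_network R)
    (O : tree_point Q) S : depth_first O S ->
  expected_time S (uniform_law Q) = ((total_length Q)%:E - mean_dist O)%E.
Proof.
move=> [[S0 Slip _] [w [lw pw _] us]].
have ws : {subset w <= rooted_legs O} by move=> l; rewrite (perm_mem pw).
have uw : uniq w by rewrite (perm_uniq pw) rooted_legs_uniq.
apply: (expected_time_tight S0 Slip) => x.
have := tour_visits S0 x us pw; move/(search_time_le Slip x (walk_len_ge0 w)).
case E: (search_time S x) (search_time_ge0 S x) => [t| |] //; rewrite !lee_fin => t0 tw.
by exists t => //; apply: (unit_speed_slack S0 Slip us lw uw ws); rewrite t0.
Qed.

Lemma df_tour_search (R : realType) (Q : tree_network R) (O : tree_point Q) w :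
  df_tour O w -> depth_first O (walk_search O w).
Proof.
move=> dw; have [lw pw _] := dw; set S := walk_search O w.
have us : unit_speed S w by exact: walk_search_unit_speed lw.
have S0 : S 0 = O by exact: walk_search0 lw.
have Slip t1 t2 : 0 <= t1 -> t1 < t2 -> dist (S t1) (S t2) <= t2 - t1.
  by move=> t10 /ltW t12; exact: (walk_search_lip lw).
have ws : {subset w <= rooted_legs O} by move=> l; rewrite (perm_mem pw).
have uw : uniq w by rewrite (perm_uniq pw) rooted_legs_uniq.
split; last by exists w.
split=> //; apply: (no_slack_normal S0 Slip) => t t0 tc.
apply: (unit_speed_slack S0 Slip us lw uw ws); rewrite t0 /=.
rewrite -lee_fin; apply: (le_trans tc); apply: ereal_inf_lbound.
exists (walk_len w) => //; split; first exact: walk_len_ge0.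
by move=> x; exact: (tour_visits S0 x us pw).
Qed.

(** * Completing a depth-first walk *)

Section PartialTours.
Context {R : realType} (Q : tree_network R) (O : tree_point Q).
Implicit Types (e : arc Q * bool) (x y v : tree_point Q) (l : leg Q).
Implicit Types (w : seq (leg Q)).

(** The clause of [df_tour] that does not need the tour to be complete. *)
Definition df_order w := forall w1 l w2, w = w1 ++ l :: w2 -> towards_root O l ->
  forall l', l' \in rooted_legs O -> leg_start l' = leg_start l ->
    l' != l -> l' \in w1.

Definition partial_tour w y :=
  [/\ leg_walk O w y, uniq w, {subset w <= rooted_legs O} & df_order w].

Lemma partial_tour_nil : partial_tour [::] O.
Proof. by split=> //=; case. Qed.

Lemma partial_tour_rcons w y l : partial_tour w y ->
  l \in rooted_legs O -> l \notin w -> leg_start l = y ->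
  (towards_root O l -> forall l', l' \in rooted_legs O ->
     leg_start l' = leg_start l -> l' != l -> l' \in w) ->
  partial_tour (rcons w l) (leg_end l).
Proof.
move=> [lw uw ws dw] lr ln ly hl; split.
- by rewrite -cats1 (leg_walk_trans lw)//= ly !eqxx.
- by rewrite rcons_uniq ln.
- by move=> k; rewrite mem_rcons inE => /predU1P[->//|/ws].
move=> w1 k w2; case: (lastP w2) => [|w2' k'].
  by rewrite cats1 => /rcons_inj[<- <-].
by rewrite -rcons_cons -rcons_cat => /rcons_inj[E _]; exact: dw E.
Qed.

Lemma leg_walk_count x w y v : leg_walk x w y ->
  (count (fun l => leg_end l == v) w + (x == v) =
   count (fun l => leg_start l == v) w + (y == v))%N.
Proof.
elim: w x => [|l w IH] x /=; first by move/eqP ->.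
by move=> /andP[/eqP -> /IH]; lia.
Qed.

Lemma count_rooted_legs v :
  count (fun l => leg_start l == v) (rooted_legs O) =
  count (fun l => leg_end l == v) (rooted_legs O).
Proof. by rewrite /rooted_legs !count_cat !count_map addnC. Qed.

Lemma count_subset (p : pred (leg Q)) w : uniq w -> {subset w <= rooted_legs O} ->
  (count p w <= count p (rooted_legs O))%N.
Proof.
move=> uw ws; rewrite -!size_filter; apply: uniq_leq_size.
  exact: filter_uniq.
by move=> l; rewrite !mem_filter => /andP[-> /ws].
Qed.

Lemma count_full (p : pred (leg Q)) w : uniq w -> {subset w <= rooted_legs O} ->
  (count p (rooted_legs O) <= count p w)%N ->
  forall l, l \in rooted_legs O -> p l -> l \in w.
Proof.
move=> uw ws h l lr pl.
have := @uniq_min_size _ [seq k <- w | p k] [seq k <- rooted_legs O | p k].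
rewrite filter_uniq// !size_filter => /(_ isT) [] //.
  by move=> k; rewrite !mem_filter => /andP[-> /ws].
by move=> _ /(_ l); rewrite !mem_filter pl lr /= => ->.
Qed.

Lemma towards_root_inj l l' : l \in rooted_legs O -> l' \in rooted_legs O ->
  towards_root O l -> towards_root O l' -> leg_start l = leg_start l' -> l = l'.
Proof.
move=> /rooted_legsP[e l0 [->|->]]; first by rewrite towards_root_out.
move=> /rooted_legsP[e' l0' [->|->]]; first by rewrite towards_root_out.
by move=> _ _; rewrite !leg_start_inn => /(arm_end_inj l0 l0') ->.
Qed.

(** A walk that cannot be continued has used every leg from its current end;
    counting arrivals and departures, this can only happen at the root. *)
Lemma stuck_at_root w y : partial_tour w y ->
  (forall l, l \in rooted_legs O -> leg_start l = y -> l \in w) -> y = O.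
Proof.
move=> [lw uw ws _] full; apply/eqP/negPn/negP => yO.
have := leg_walk_count y lw; rewrite eqxx (eq_sym O) (negPf yO) addn0.
have h : (count (fun l => leg_start l == y) (rooted_legs O) <=
    count (fun l => leg_start l == y) w)%N.
  rewrite -!size_filter; apply: uniq_leq_size.
    by rewrite filter_uniq ?rooted_legs_uniq.
  by move=> l; rewrite !mem_filter => /andP[ly lr]; rewrite ly full//; exact/eqP.
have := count_subset (fun l => leg_end l == y) uw ws.
rewrite -count_rooted_legs; lia.
Qed.

(** The walk being closed, a point from which all the legs have been used has
    also been reached by all its legs. The inward leg of an arm was only taken
    when all the other legs from the far end of the arm were used, so this
    property spreads from the root to the whole tree. *)
Lemma stuck_complete w : partial_tour w O ->
  (forall l, l \in rooted_legs O -> leg_start l = O -> l \in w) -> df_tour O w.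
Proof.
move=> [lw uw ws dw] full.
pose sat v := forall l, l \in rooted_legs O -> leg_start l = v -> l \in w.
(* As many legs end at [v] as start there, and the closed walk [w] arrives at
   [v] as often as it leaves. *)
have arrive v : sat v -> forall l, l \in rooted_legs O -> leg_end l = v -> l \in w.
  move=> sv l lr lv; apply: (count_full (p := fun l => leg_end l == v) uw ws) => //.
    have /addIn -> := leg_walk_count v lw.
    rewrite -count_rooted_legs -!size_filter; apply: uniq_leq_size.
      by rewrite filter_uniq ?rooted_legs_uniq.
    by move=> k; rewrite !mem_filter => /andP[kv kr]; rewrite kv sv//; exact/eqP.
  exact/eqP.
have up e : 0 < arm_len O e -> sat (arm_point O e 0) -> sat (arm_point O e (arm_len O e)).
  move=> l0 se; have er : inn O e \in rooted_legs O.
    by apply/rooted_legsP; exists e => //; right.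
  have := arrive _ se _ er (leg_end_inn O e) => ew.
  have [w1 [w2 E]] : exists w1 w2, w = w1 ++ inn O e :: w2.
    by case/splitPr: ew => w1 w2; exists w1, w2.
  move=> l lr ls; case: (eqVneq l (inn O e)) => [->//|ln].
  rewrite E mem_cat (dw _ _ _ E)//; first exact: towards_root_inn.
  by rewrite leg_start_inn.
(* By induction on the number of legs that start nearer to the root. *)
have all_sat : forall v, (exists2 l, l \in rooted_legs O & leg_start l = v) -> sat v.
  move=> v; have [n] := ubnP (count (fun k => dist O (leg_start k) < dist O v) (rooted_legs O)).
  elim: n v => // n IH v hn [l lr lv].
  case: (eqVneq v O) => [->//|vO].
  have [e [l0 ev]] : exists e, 0 < arm_len O e /\ arm_point O e (arm_len O e) = v.
    move: lr lv => /rooted_legsP[e l0 [->|->]].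
      rewrite leg_start_out => ev; case: (arm_start_cases O e) => [h|[v' h]].
        by move: vO; rewrite -ev h eqxx.
      by rewrite -ev h; apply: arm_to_node; rewrite -h ev.
    by rewrite leg_start_inn => <-; exists e.
  rewrite -ev; apply: up => //.
  have er : out O e \in rooted_legs O by apply/rooted_legsP; exists e => //; left.
  apply: IH; last by exists (out O e); rewrite ?leg_start_out.
  have dd : dist O (arm_point O e 0) < dist O v.
    by rewrite -ev [ltRHS]depth_arm_point ?armlP// ltrDl.
  rewrite -ltnS; apply: leq_trans hn; rewrite ltnS -!size_filter.
  have /uniq_leq_size : uniq (out O e :: [seq k <- rooted_legs O |
      dist O (leg_start k) < dist O (arm_point O e 0)]).
    by rewrite /= filter_uniq ?rooted_legs_uniq// mem_filter leg_start_out ltxx.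
  apply=> k; rewrite inE !mem_filter => /predU1P[->|/andP[kd ->]].
    by rewrite er leg_start_out dd.
  by rewrite (lt_trans kd).
split=> //; apply: uniq_perm; rewrite ?rooted_legs_uniq// => l.
apply/idP/idP => [/ws //|lr]; by apply: (all_sat (leg_start l)) => //; exists l.
Qed.

(** The walk can be prolonged greedily: outward legs are always allowed, and
    when none is left the only other leg is the one towards the root. *)
Lemma partial_tour_extend w y : partial_tour w y ->
  exists w', df_tour O (w ++ w').
Proof.
have [n] := ubnP (size (rooted_legs O) - size w).
elim: n w y => // n IH w y hn pw; have [lw uw ws dw] := pw.
pose ok l := (l \notin w) && (leg_start l == y).
case: (boolP (has ok (rooted_legs O))) => [|/hasPn full]; last first.
  have {}full l : l \in rooted_legs O -> leg_start l = y -> l \in w.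
    by move=> /full; rewrite negb_and negbK => /orP[//|/eqP h1 h2].
  have yO := stuck_at_root pw full; exists [::]; rewrite cats0.
  by rewrite yO in pw full; exact: stuck_complete.
move=> h; suff [l [lr ln ly hl]] : exists l, [/\ l \in rooted_legs O, l \notin w,
    leg_start l = y & towards_root O l -> forall l', l' \in rooted_legs O ->
     leg_start l' = leg_start l -> l' != l -> l' \in w].
  have pw' := partial_tour_rcons pw lr ln ly hl.
  have [|w' dw'] := IH _ _ _ pw'; last by exists (l :: w'); rewrite -cat_rcons.
  have : (size (rcons w l) <= size (rooted_legs O))%N.
    by case: pw' => _ u' s' _; exact: uniq_leq_size.
  by rewrite size_rcons; lia.
case/hasP: h => l lr /andP[ln /eqP ly].
case: (boolP (has (fun k => ok k && ~~ towards_root O k) (rooted_legs O))).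
  move=> /hasP[k kr /andP[/andP[kn /eqP ky] kt]]; exists k; split=> //.
  by rewrite (negPf kt).
move=> /hasPn h; exists l; split=> // lt l' lr' ll' ne; apply/negPn/negP => ln'.
have := h l' lr'; rewrite /ok ln' ll' ly eqxx /= negbK => lt'.
by move: ne; rewrite (towards_root_inj lr' lr lt' lt ll') eqxx.
Qed.

End PartialTours.

(** * Slackless searches follow a depth-first walk *)

Section UnitSpeed.
Context {R : realType} (Q : tree_network R) (O : tree_point Q).
Variable S : R -> tree_point Q.
Implicit Types (e : arc Q * bool) (y : tree_point Q) (l : leg Q) (w : seq (leg Q)).
Implicit Types (s t u : R).

Lemma unit_speed_prefix w l : unit_speed S (rcons w l) -> unit_speed S w.
Proof.
move=> us w1 k w2 E; apply: (us w1 k (rcons w2 l)).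
by rewrite E rcons_cat.
Qed.

Lemma unit_speed_last w l s : unit_speed S (rcons w l) -> 0 <= s <= leg_len l ->
  S (walk_len w + s) = leg_at l s.
Proof. by move=> us; apply: (us w l [::]); rewrite cats1. Qed.

Lemma unit_speed_rcons w l : unit_speed S w ->
  (forall s, 0 <= s <= leg_len l -> S (walk_len w + s) = leg_at l s) ->
  unit_speed S (rcons w l).
Proof.
move=> us h w1 k w2; case: (lastP w2) => [|w2' k'].
  by rewrite cats1 => /rcons_inj[<- <-].
by rewrite -rcons_cons -rcons_cat => /rcons_inj[E _]; exact: us E.
Qed.

Lemma walk_len_rcons w l : walk_len (rcons w l) = walk_len w + leg_len l.
Proof. by rewrite -cats1 walk_len_cat [walk_len [:: l]]/walk_len big_seq1. Qed.

Hypothesis S0 : S 0 = O.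

Lemma unit_speed_walk_end w y : unit_speed S w -> leg_walk O w y ->
  S (walk_len w) = y.
Proof.
case: (lastP w) => [|w' l] us; first by rewrite /walk_len big_nil S0 /= => /eqP.
rewrite -cats1 => /leg_walk_cat[z _ /= /andP[_ /eqP <-]].
rewrite cats1 walk_len_rcons (unit_speed_last us) ?leg_at_len//.
by rewrite lexx leg_len_ge0.
Qed.

(** The walk comes back through an arm only after having gone down it. *)
Lemma unvisited_arm e w y u : 0 < arm_len O e -> unit_speed S w ->
  leg_walk O w y -> {subset w <= rooted_legs O} -> out O e \notin w ->
  0 <= u <= walk_len w -> arm_coord O e (S u) = 0.
Proof.
move=> l0; elim/last_ind: w y u => [|w l IH] y u us lw ws ew uw.
  have -> : u = 0.
    by apply/eqP; rewrite eq_le; case/andP: uw => -> ; rewrite /walk_len big_nil => ->.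
  by rewrite S0 arm_coord_root.
have [z wz lz] : exists2 z, leg_walk O w z & leg_start l = z.
  by move: lw; rewrite -cats1 => /leg_walk_cat[z wz /= /andP[/eqP lz _]]; exists z.
have us' := unit_speed_prefix us.
have ws' : {subset w <= rooted_legs O}.
  by move=> k kw; apply: ws; rewrite mem_rcons inE kw orbT.
move: ew; rewrite mem_rcons inE negb_or => /andP[el ew].
have {}IH v := IH z v us' wz ws' ew.
case: (leP u (walk_len w)) => [uw'|wu].
  by apply: IH; rewrite uw'; case/andP: uw => ->.
have zero : arm_coord O e (leg_start l) = 0.
  by rewrite lz -(unit_speed_walk_end us' wz) IH// walk_len_ge0 lexx.
have sl : 0 <= u - walk_len w <= leg_len l.
  by case/andP: uw => _; rewrite walk_len_rcons => h; apply/andP; split; lra.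
have := unit_speed_last us sl; rewrite subrKC => ->.
have /rooted_legsP[e' l0' le] : l \in rooted_legs O.
  by apply: ws; rewrite mem_rcons inE eqxx.
case: le => le; rewrite le in sl el zero *.
  have ne : e != e' by apply: contra el => /eqP ->.
  rewrite leg_at_out// arm_coord_other//; last by rewrite -(leg_len_out O).
  by rewrite -leg_start_out.
case: (eqVneq e e') => [E|ne].
  by move: zero l0; rewrite leg_start_inn -E arm_coordK ?armlP// => ->; rewrite ltxx.
rewrite leg_at_inn// arm_coord_other//; last first.
  by move: sl; rewrite leg_len_inn => /andP[? ?]; apply/andP; split; lra.
by move: zero; rewrite leg_start_inn arm_coord_other ?armlP.
Qed.

Hypothesis Slip : forall t1 t2, 0 <= t1 -> t1 < t2 ->
  dist (S t1) (S t2) <= t2 - t1.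

Lemma unit_speed_closed l t L : 0 <= t -> 0 < L ->
  (forall s, 0 <= s < L -> S (t + s) = leg_at l s) -> S (t + L) = leg_at l L.
Proof.
move=> t0 L0 h; apply: dist_eq0; apply/eqP; rewrite eq_le dist_ge0 andbT.
rewrite leNgt; apply/negP; set x := dist _ _ => x0.
pose s := Num.max 0 (L - x / 4).
have sL : 0 <= s < L by rewrite /s le_max lexx /= gt_max L0 /=; lra.
have sx : L - x / 4 <= s by rewrite /s le_max lexx orbT.
case/andP: (sL) => s0 sL'.
have h1 : dist (S (t + s)) (S (t + L)) <= t + L - (t + s).
  by apply: (search_lip Slip); lra.
have h2 : dist (leg_at l s) (leg_at l L) <= L - s by apply: leg_at_lip; exact: ltW.
have h3 := dist_triangle (S (t + L)) (leg_at l s) (leg_at l L).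
rewrite -/x (dist_sym (S (t + L))) in h3; rewrite h// in h1; lra.
Qed.

End UnitSpeed.

Section Follow.
Context {R : realType} (Q : tree_network R) (O : tree_point Q).
Variable S : R -> tree_point Q.
Hypothesis S0 : S 0 = O.
Hypothesis Slip : forall t1 t2, 0 <= t1 -> t1 < t2 ->
  dist (S t1) (S t2) <= t2 - t1.
Variable tau : R.
Hypothesis no_slack : forall t, 0 <= t <= tau -> slack O S t <= 0.
Hypothesis full : forall e, reach O S e tau = arm_len O e.
Hypothesis first_full : forall t, 0 <= t ->
  (forall e, reach O S e t = arm_len O e) -> tau <= t.
Implicit Types (e : arc Q * bool) (y : tree_point Q) (l : leg Q) (w : seq (leg Q)).
Implicit Types (s t u : R).

Let d e t := arm_coord O e (S t).
Let M e t := reach O S e t.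

Let slackE t : 0 <= t <= tau -> slack O S t = 0.
Proof.
move=> h; apply/eqP; rewrite eq_le no_slack//= (slack_ge0 S0 Slip)//.
by case/andP: h.
Qed.

(* Once below its record, an arm coordinate never grows again. *)
Let descend e s u : 0 <= s -> s <= u <= tau -> d e s < M e s -> d e u <= d e s.
Proof.
move=> s0 sut h; apply: (no_climb Slip s0 sut) => //.
have st : s <= tau by case/andP: sut => /le_trans; exact.
by rewrite !slackE ?s0 ?st ?lexx ?(le_trans s0).
Qed.

(* As the arm is eventually explored to its end, by [descend] its coordinate
   cannot leave its record before. *)
Let ascend e t : 0 <= t <= tau -> M e t < arm_len O e -> d e t = M e t.
Proof.
move=> /andP[t0 tt] h; apply/eqP; rewrite eq_le (reach_self O S)//= leNgt.
apply/negP => dm; move: h; rewrite -(full e) ltNge => /negP; apply.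
apply: (reach_le Slip) => [|u /andP[u0 ut]]; first exact: le_trans tt.
case: (leP u t) => tu; first by apply: reach_ub; rewrite u0.
apply: ltW; apply: (le_lt_trans _ dm); apply: descend => //.
by rewrite (ltW tu).
Qed.

Let reach_const e t0 t : 0 <= t0 -> t0 <= t ->
  (forall u, t0 < u <= t -> d e u <= M e t0) -> M e t = M e t0.
Proof.
move=> t00 tt h; apply/eqP; rewrite eq_le [X in _ && X](reach_mono O Slip e t00 tt) andbT.
apply: (reach_le Slip) => [|u /andP[u0 ut]]; first exact: le_trans tt.
case: (leP u t0) => tu; first by apply: reach_ub; rewrite u0.
by apply: h; rewrite tu.
Qed.

Variables (w : seq (leg Q)) (y : tree_point Q).
Hypothesis pw : partial_tour O w y.
Hypothesis us : unit_speed S w.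
Let t0 := walk_len w.
Hypothesis t0tau : t0 < tau.

Let t00 : 0 <= t0. Proof. exact: walk_len_ge0. Qed.

Let St0 : S t0 = y.
Proof. by case: pw => lw _ _ _; exact: unit_speed_walk_end lw. Qed.

Let used e : 0 < arm_len O e -> 0 < M e t0 -> out O e \in w.
Proof.
move=> l0 M0; apply/negPn/negP => ew; case: pw => lw _ ws _.
have [u ut] := reachP O Slip e t00.
rewrite (unvisited_arm S0 l0 us lw ws ew)// => h.
by move: M0; rewrite /M -h ltxx.
Qed.

Let used_full e : out O e \in w -> M e t0 = arm_len O e.
Proof.
move=> ew; apply/eqP; rewrite eq_le (reach_le_len O Slip)//=.
have [w1 [w2 E]] : exists w1 w2, w = w1 ++ out O e :: w2.
  by case/splitPr: ew => w1 w2; exists w1, w2.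
rewrite -[leLHS](arm_coordK (armlP O e)) -leg_end_out -(unit_speed_end us E).
apply: reach_ub; rewrite addr_ge0 ?walk_len_ge0 ?leg_len_ge0//= /t0 E.
by rewrite walk_len_cat lerD2l /walk_len big_cons lerDl walk_len_ge0.
Qed.

Definition next_leg l := [/\ l \in rooted_legs O, l \notin w, leg_start l = y,
    (towards_root O l -> forall l', l' \in rooted_legs O ->
     leg_start l' = leg_start l -> l' != l -> l' \in w) &
    t0 + leg_len l <= tau /\
    forall s, 0 <= s <= leg_len l -> S (t0 + s) = leg_at l s].

(** New points keep being discovered on an arm [e], which the search therefore
    enters at once. By [ascend] it stays at its record on [e], so inside [e],
    until the far end; zero slack then gives its speed. *)
Lemma next_leg_out e : (forall t, t0 < t <= tau -> M e t0 < M e t) ->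
  next_leg (out O e).
Proof.
move=> inc; have ttau := ltW t0tau.
have ew : out O e \notin w.
  apply/negP => /used_full h; have := inc tau; rewrite t0tau lexx => /(_ isT).
  by rewrite h /M full ltxx.
have M00 : M e t0 = 0.
  apply/eqP; rewrite eq_le [X in _ && X](reach_ge0 O Slip)// andbT leNgt.
  apply/negP => h; move/negP: ew; apply; apply: used => //.
  exact: lt_le_trans h (reach_le_len O Slip e t00).
have l0 : 0 < arm_len O e.
  by have := inc tau; rewrite t0tau lexx M00 /M full => /(_ isT).
have Mlip t : t0 <= t -> M e t <= t - t0.
  by move=> tt; have := reach_lip O Slip e t00 tt; rewrite -/(M e t0) M00 add0r.
have inside u : t0 < u <= tau -> M e u < arm_len O e ->
    [/\ d e u = M e u, 0 < d e u & S u = arm_point O e (d e u)].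
  move=> hu Ml; have dM : d e u = M e u.
    by apply: ascend => //; case/andP: hu => /ltW/(le_trans t00) -> ->.
  have d0 : 0 < d e u by rewrite dM -M00 inc.
  by split=> //; rewrite /d arm_pointK// -/(d e u) d0 dM.
(* Points of [e] close to its near end are visited soon after [t0]. *)
have ystart : y = arm_point O e 0.
  apply: dist_eq0; apply/eqP; rewrite eq_le dist_ge0 andbT leNgt; apply/negP.
  set x := dist _ _ => x0.
  pose u := Num.min tau (t0 + Num.min (x / 4) (arm_len O e / 2)).
  have m0 : 0 < Num.min (x / 4) (arm_len O e / 2) by rewrite lt_min; apply/andP; split; lra.
  have hu : t0 < u <= tau.
    by rewrite lt_min t0tau ge_min lexx /= andbT; lra.
  have u1 : u - t0 <= x / 4.
    rewrite lerBlDl ge_min lerD2l ge_min lexx /= orbT//.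
  have u2 : u - t0 <= arm_len O e / 2.
    by rewrite lerBlDl ge_min lerD2l ge_min lexx /= !orbT.
  have tu : t0 <= u by case/andP: hu => /ltW.
  have Mu := Mlip u tu.
  have [|dM d0 Su] := inside u hu; first lra.
  have h1 := search_lip Slip t00 tu.
  have h2 : dist (S u) (arm_point O e 0) = d e u.
    rewrite Su dist_arm_point ?arm0P ?subr0 ?gtr0_norm//.
    by rewrite (ltW d0) /d arm_coord_le.
  have := dist_triangle (S t0) (S u) (arm_point O e 0).
  by rewrite St0 -/x in h1 *; rewrite h2 dM; lra.
have d00 : d e t0 = 0 by rewrite /d St0 ystart arm_coordK ?arm0P.
have timing t : t0 < t <= tau -> t - t0 < arm_len O e -> d e t = t - t0.
  move=> ht tl; have tt : t0 <= t by case/andP: ht => /ltW.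
  have t1 : t <= tau by case/andP: ht.
  have Mt u : t0 < u <= t -> M e u < arm_len O e.
    move=> /andP[hu ut]; apply: le_lt_trans (Mlip u (ltW hu)) _; lra.
  have [|dM d0 St] := inside t ht; first by apply: Mt; case/andP: ht => ->; rewrite lexx.
  have other e' : e' != e -> M e' t = M e' t0.
    move=> ne; apply: reach_const => // u /andP[tu ut].
    have [||_ d0u Su] := inside u; first by rewrite tu (le_trans ut).
      by apply: Mt; rewrite tu.
    rewrite /d Su arm_coord_other// ?(ltW d0u) ?arm_coord_le// -ystart -St0.
    exact: reach_self.
  have := slackE (t := t); rewrite t1 (le_trans t00)// => /(_ isT).
  have := slackE (t := t0); rewrite t00 ttau => /(_ isT).
  rewrite /slack (bigD1 e)//= [in X in _ -> X](bigD1 e)//=.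
  rewrite -[reach O S e t0]/(M e t0) -[reach O S e t]/(M e t) M00.
  rewrite (eq_bigr (fun e' => reach O S e' t0)) => [|e' /other //].
  rewrite St0 ystart St [dist O (arm_point O e (d e t))]depth_arm_point; last first.
    by rewrite arm_coord_ge0 arm_coord_le.
  rewrite (eq_bigr _ other) -dM -/(d e t).
  set X := \sum_(_ | _) _; lra.
have ltau : t0 + arm_len O e <= tau.
  rewrite leNgt; apply/negP => h; have := Mlip tau ttau.
  by rewrite /M full; lra.
have pos s : 0 <= s < arm_len O e -> S (t0 + s) = leg_at (out O e) s.
  move=> /andP[s0 sl]; rewrite leg_at_out//.
  move: s0; rewrite le_eqVlt => /predU1P[<-|s0]; first by rewrite addr0 St0 ystart.
  have ht : t0 < t0 + s <= tau by apply/andP; split; lra.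
  have ds : d e (t0 + s) = s by rewrite timing//; lra.
  by rewrite -[in RHS]ds /d arm_pointK// -/(d e _) ds s0.
split; rewrite ?leg_len_out//.
- by apply/rooted_legsP; exists e => //; left.
- by rewrite leg_start_out ystart.
- by rewrite towards_root_out.
split=> // s /andP[s0]; rewrite le_eqVlt => /predU1P[->|sl].
  exact: (unit_speed_closed Slip).
by apply: pos; rewrite s0.
Qed.

(** As long as nothing new is discovered, zero slack makes the depth decrease
    at unit speed, so the search leaves its present position by the arm leading
    to the root. By [descend] it will never be back, hence everything beyond has
    been explored, and inside the arm, already explored, it can only go on to
    the near end. *)
Lemma next_leg_inn t1 : t0 < t1 <= tau -> (forall e, M e t1 = M e t0) ->
  exists e, next_leg (inn O e).
Proof.
move=> /andP[t01 t1t] Mc; have ttau := ltW t0tau.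
have depth t : t0 <= t <= t1 -> dist O (S t) = dist O y - (t - t0).
  move=> /andP[tt tt1]; have Mt e : reach O S e t = reach O S e t0.
    apply/eqP; rewrite eq_le; apply/andP; split; last exact: (reach_mono O Slip).
    by rewrite -[leRHS](Mc e) (reach_mono O Slip)// (le_trans t00).
  have := slackE (t := t); rewrite (le_trans t00)// (le_trans tt1)// => /(_ isT).
  have := slackE (t := t0); rewrite t00 ttau => /(_ isT).
  rewrite /slack St0 (eq_bigr _ (fun e _ => Mt e)); lra.
have yO : y != O.
  apply/eqP => yO; have := depth t1; rewrite (ltW t01) lexx => /(_ isT).
  by have := dist_ge0 O (S t1); rewrite yO dist_refl; lra.
have [e [l0 ey]] : exists e, 0 < arm_len O e /\ arm_point O e (arm_len O e) = y.
  case: pw => lw _ ws _; case: (lastP w) lw ws => [/= /eqP h|w' l lw ws].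
    by move: yO; rewrite h eqxx.
  have ly : leg_end l = y.
    by move: lw; rewrite -cats1 => /leg_walk_cat[z _ /= /andP[_ /eqP]].
  have /rooted_legsP[e l0 le] : l \in rooted_legs O.
    by apply: ws; rewrite mem_rcons inE eqxx.
  case: le => le; rewrite le in ly; first by exists e; rewrite -leg_end_out.
  rewrite leg_end_inn in ly; case: (arm_start_cases O e) => [h|[v h]].
    by move: yO; rewrite -ly h eqxx.
  by rewrite -ly h; apply: arm_to_node; rewrite -h ly.
exists e; have de0 : d e t0 = arm_len O e by rewrite /d St0 -ey arm_coordK ?armlP.
have Me0 t : t0 <= t -> M e t = arm_len O e.
  move=> tt; apply/eqP; rewrite eq_le (reach_le_len O Slip) ?(le_trans t00)//=.
  by rewrite -de0; apply: reach_ub; rewrite t00.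
have below t : t0 < t <= tau -> d e t < arm_len O e.
  have low u : t0 < u <= t1 -> d e u < arm_len O e.
    move=> /andP[tu ut]; rewrite lt_neqAle /d arm_coord_le andbT; apply/eqP => h.
    have := @depth_ge_arm _ _ O e (S u); rewrite h l0 => /(_ isT).
    rewrite -depth_arm_point ?armlP// ey depth ?(ltW tu)//; lra.
  move=> /andP[tt ht]; case: (leP t t1) => t1t'; first by apply: low; rewrite tt.
  apply: (@le_lt_trans _ _ (d e t1)); last by apply: low; rewrite t01 lexx.
  apply: descend; first exact: le_trans t00 (ltW t01).
    by rewrite (ltW t1t').
  by rewrite Me0 ?(ltW t01)// low// t01 lexx.
have child e' : 0 < arm_len O e' -> arm_point O e' 0 = y -> out O e' \in w.
  move=> l0' ey'; apply: used => //.
  rewrite -(@reach_const e' t0 tau t00 ttau) ?/M ?full// => u hu.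
  by rewrite /d (arm_coord_child l0 _ (below u hu)) ?(reach_ge0 O Slip)// ey.
have timing t : t0 < t <= tau -> t - t0 < arm_len O e ->
    d e t = arm_len O e - (t - t0) /\ forall e', M e' t = M e' t0.
  move=> ht tl; have tt : t0 <= t by case/andP: ht => /ltW.
  have pos u : t0 < u <= t -> 0 < d e u < arm_len O e.
    move=> /andP[hu ut]; rewrite below ?hu ?andbT; last first.
      by case/andP: ht => _; exact: le_trans.
    have := search_lip Slip t00 (ltW hu).
    have := arm_lipschitz O e (S t0) (S u).
    rewrite ler_norml -/(d e t0) -/(d e u) de0 => /andP[_ h1] h2; lra.
  have Mt e' : M e' t = M e' t0.
    apply: reach_const => // u hu; case: (eqVneq e' e) => [->|ne].
      by rewrite Me0// ltW//; case/andP: (pos u hu).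
    have /andP[d0 d1] := pos u hu.
    rewrite /d -[S u](arm_pointK (pos u hu)) arm_coord_other ?(ltW d0) ?(ltW d1)//.
    rewrite -(arm_coord_other ne (armlP O e)) ey -St0; exact: reach_self.
  split=> //; have hpos := pos t; have {}hpos : 0 < d e t < arm_len O e.
    by apply: hpos; case/andP: ht => ->; rewrite lexx.
  have := slackE (t := t); rewrite (le_trans t00)//; case/andP: (ht) => _ -> /(_ isT).
  have := slackE (t := t0); rewrite t00 ttau => /(_ isT).
  rewrite /slack (eq_bigr _ (fun e' _ => Mt e')) -/(M _ _).
  rewrite St0 -ey depth_arm_point ?armlP// -{1}[S t](arm_pointK hpos).
  rewrite [dist O (arm_point O e (arm_coord O e (S t)))]depth_arm_point.
    rewrite -/(d e t); lra.
  by case/andP: hpos => /ltW -> /ltW ->.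
have ltau : t0 + arm_len O e <= tau.
  rewrite leNgt; apply/negP => h.
  have [||_ Mt] := timing tau; [by rewrite t0tau lexx|lra|].
  suff : tau <= t0 by rewrite leNgt t0tau.
  by apply: first_full => // e'; rewrite -[LHS]/(M e' t0) -Mt /M full.
have pos s : 0 <= s < arm_len O e -> S (t0 + s) = leg_at (inn O e) s.
  move=> /andP[s0 sl]; rewrite leg_at_inn//.
  move: s0; rewrite le_eqVlt => /predU1P[<-|s0]; first by rewrite addr0 subr0 St0 ey.
  have ht : t0 < t0 + s <= tau by apply/andP; split; lra.
  have [|ds _] := timing _ ht; first lra.
  have {}ds : d e (t0 + s) = arm_len O e - s by rewrite ds; lra.
  rewrite -[in RHS]ds /d arm_pointK// -/(d e _) ds; apply/andP; split; lra.
split; rewrite ?leg_len_inn//.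
- by apply/rooted_legsP; exists e => //; right.
- apply/negP => ew; have [w1 [w2 E]] : exists w1 w2, w = w1 ++ inn O e :: w2.
    by case/splitPr: ew => w1 w2; exists w1, w2.
  have h1 := unit_speed_start us E; have h2 := unit_speed_end us E.
  rewrite leg_start_inn leg_end_inn leg_len_inn in h1 h2.
  have w10 := walk_len_ge0 w1.
  have tE : walk_len w1 + arm_len O e <= t0.
    rewrite /t0 E walk_len_cat lerD2l /walk_len big_cons leg_len_inn lerDl.
    exact: walk_len_ge0.
  have dE : d e (walk_len w1 + arm_len O e) = 0 by rewrite /d h2 arm_coordK ?arm0P.
  have ME : arm_len O e <= M e (walk_len w1 + arm_len O e).
    rewrite -[leLHS](arm_coordK (armlP O e)) -h1; apply: reach_ub.
    by rewrite w10 lerDl ltW.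
  have := @descend e (walk_len w1 + arm_len O e) t0.
  rewrite addr_ge0 ?(ltW l0)// tE ttau dE de0 => /(_ isT isT) h.
  by have := h (lt_le_trans l0 ME); rewrite leNgt l0.
- by rewrite leg_start_inn.
- move=> _ l' /rooted_legsP[e' l0' [->|->]] ls ne.
    by apply: child => //; rewrite -leg_start_out ls leg_start_inn.
  by move: ne; rewrite (arm_end_inj l0' l0) ?eqxx// -!leg_start_inn.
split=> // s /andP[s0]; rewrite le_eqVlt => /predU1P[->|sl].
  exact: (unit_speed_closed Slip).
by apply: pos; rewrite s0.
Qed.

Lemma next_leg_exists : exists l, next_leg l.
Proof.
case: (pselect (exists e, forall t, t0 < t <= tau -> M e t0 < M e t)) => [[e h]|nh].
  by exists (out O e); exact: next_leg_out.
have /choice[v hv] : forall e, exists t, t0 < t <= tau /\ M e t = M e t0.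
  move=> e; apply: contrapT => h; apply: nh; exists e => t ht.
  rewrite lt_neqAle (reach_mono O Slip) ?andbT//; last by case/andP: ht => /ltW.
  by apply/eqP => E; apply: h; exists t.
pose t1 := \big[Num.min/tau]_e v e.
have t1v e : t1 <= v e by rewrite /t1 bigmin_le_cond.
have t1t : t1 <= tau by rewrite /t1 bigmin_le_id.
have t01 : t0 < t1.
  by apply/bigmin_gtP; split=> // e _; case/andP: (hv e).1.
have [|e|e he] := @next_leg_inn t1; first by rewrite t01.
  apply/eqP; rewrite eq_le [X in _ && X](reach_mono O Slip e t00 (ltW t01)) andbT.
  rewrite -[leRHS](hv e).2 (reach_mono O Slip)//; exact: le_trans t00 (ltW t01).
by exists (inn O e).
Qed.

End Follow.

(** As a depth-first walk has bounded size, adding legs one by one leads to a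
    walk that ends when the search has visited everything. *)
Lemma follow_tour (R : realType) (Q : tree_network R) (O : tree_point Q)
    (S : R -> tree_point Q) (tau : R) : 0 <= tau -> S 0 = O ->
  (forall t1 t2, 0 <= t1 -> t1 < t2 -> dist (S t1) (S t2) <= t2 - t1) ->
  (forall t, 0 <= t <= tau -> slack O S t <= 0) ->
  (forall e, reach O S e tau = arm_len O e) ->
  (forall t, 0 <= t -> (forall e, reach O S e t = arm_len O e) -> tau <= t) ->
  exists w y, [/\ partial_tour O w y, unit_speed S w & walk_len w = tau].
Proof.
move=> tau0 S0 Slip ns full ff.
suff ext n w y : (size (rooted_legs O) - size w < n)%N -> partial_tour O w y ->
    unit_speed S w -> walk_len w <= tau -> exists w y,
    [/\ partial_tour O w y, unit_speed S w & walk_len w = tau].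
  apply: (ext _ [::] O (ltnSn _) (partial_tour_nil O)); first by case.
  by rewrite /walk_len big_nil.
elim: n w y => // n IH w y hn pw us; rewrite le_eqVlt => /predU1P[wt|wt].
  by exists w, y.
have [l [lr ln ly hl [lt Sl]]] := next_leg_exists S0 Slip ns full ff pw us wt.
have pw' := partial_tour_rcons pw lr ln ly hl.
apply: (IH _ _ _ pw'); first last.
- by rewrite walk_len_rcons.
- exact: unit_speed_rcons.
have : (size (rcons w l) <= size (rooted_legs O))%N.
  by case: pw' => _ u' s' _; exact: uniq_leq_size.
by move: hn; rewrite size_rcons; lia.
Qed.

(** * Optimal searches *)

Section Optimality.
Local Open Scope classical_set_scope.
Context {R : realType} (Q : tree_network R) (O : tree_point Q).
Implicit Types (S : R -> tree_point Q) (x : tree_point Q).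

Lemma depth_first_exists : exists S, depth_first O S.
Proof.
have [w dw] := partial_tour_extend (partial_tour_nil O).
by exists (walk_search O w); exact: df_tour_search.
Qed.

Lemma depth_first_optimal S : depth_first O S -> optimal O (uniform_law Q) S.
Proof.
move=> dS; split; first by case: dS.
move=> S' [S0 Slip _]; rewrite (depth_first_expected_time dS).
exact: expected_time_ge.
Qed.

Lemma min_timeE :
  min_time O (uniform_law Q) = ((total_length Q)%:E - mean_dist O)%E.
Proof.
have [S dS] := depth_first_exists; apply/eqP; rewrite eq_le; apply/andP; split.
  apply: ereal_inf_lbound; exists S; first by case: dS.
  exact: depth_first_expected_time.
apply: le_ereal_inf_tmp => _ [S' [S0 Slip _] <-].
exact: expected_time_ge.
Qed.

Lemma cover_time_le S t : 0 <= t -> (forall x, visited S t x) ->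
  (cover_time S <= t%:E)%E.
Proof. by move=> t0 h; apply: ereal_inf_lbound; exists t. Qed.

Lemma cover_time_visited S tau :
  (forall t1 t2, 0 <= t1 -> t1 < t2 -> dist (S t1) (S t2) <= t2 - t1) ->
  0 <= tau -> cover_time S = tau%:E -> forall x, visited S tau x.
Proof.
move=> Slip tau0 ct x; apply/(search_time_le Slip x tau0); rewrite -ct.
apply: le_ereal_inf_tmp => _ [t [t0 h] <-].
by apply/(search_time_le Slip x t0); exact: h.
Qed.

(** An optimal search has no slack until it has visited everything, at the time
    [tau]; its trajectory up to then is a depth-first walk, which extends to a
    tour. *)
Lemma uniform_strongly_simply_searchable :
  strongly_simply_searchable O (uniform_law Q).
Proof.
move=> S [[S0 Slip _] opt].
have late t : 0 <= t -> 0 < slack O S t -> forall x, visited S t x.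
  apply: (optimal_no_slack S0 Slip); have [S1 dS1] := depth_first_exists.
  by rewrite -(depth_first_expected_time dS1); apply: opt; case: dS1.
have mu0 := total_length_gt0 Q.
have [tau tau0 ct] : exists2 tau, 0 <= tau & cover_time S = tau%:E.
  (* At this time the slack is positive, whatever has been visited. *)
  pose t := 2 * total_length Q + 1; have t0 : 0 <= t by rewrite /t; lra.
  have : (cover_time S <= t%:E)%E.
    apply: cover_time_le => //; apply: late => //; rewrite /slack.
    have : \sum_e reach O S e t <= total_length Q.
      by rewrite -(sum_arm_len O); apply: ler_sum => e _; exact: (reach_le_len O Slip).
    by have := dist_ge0 O (S t); rewrite /t; lra.
  have : (0 <= cover_time S)%E.
    by apply: le_ereal_inf_tmp => _ [r [r0 _] <-]; rewrite lee_fin.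
  by case: (cover_time S) => [r| |]//; rewrite lee_fin => r0 _; exists r.
have cov := cover_time_visited Slip tau0 ct.
have first t : 0 <= t -> (forall x, visited S t x) -> tau <= t.
  by move=> t0 h; rewrite -lee_fin -ct cover_time_le.
have ns1 t : 0 <= t < tau -> slack O S t <= 0.
  move=> /andP[t0 tt]; rewrite leNgt; apply/negP => /(late _ t0)/(first _ t0).
  by rewrite leNgt tt.
have ns t : 0 <= t <= tau -> slack O S t <= 0.
  move=> /andP[t0]; rewrite le_eqVlt => /predU1P[->|tt]; last by rewrite ns1 ?t0.
  move: tau0; rewrite le_eqVlt => /predU1P[<-|tau0]; first by rewrite (slack0 S0 Slip).
  rewrite leNgt; apply/negP => x0; set x := slack O S tau in x0.
  pose s := Num.max 0 (tau - x / 4).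
  have sL : 0 <= s < tau by rewrite /s le_max lexx /= gt_max tau0 /=; lra.
  have sx : tau - x / 4 <= s by rewrite /s le_max lexx orbT.
  have := ns1 s sL; case/andP: sL => s0 sL'.
  have h1 := search_lip Slip s0 (ltW sL').
  have h2 := dist_triangle O (S s) (S tau).
  have : \sum_e reach O S e s <= \sum_e reach O S e tau.
    by apply: ler_sum => e _; apply: (reach_mono O Slip) => //; exact: ltW.
  by move: x0 sx; rewrite /x /slack; lra.
have full e : reach O S e tau = arm_len O e.
  apply/eqP; rewrite eq_le (reach_le_len O Slip)//=.
  rewrite -[leLHS](arm_coordK (armlP O e)); apply: reach_visited; exact: cov.
have ff t : 0 <= t -> (forall e, reach O S e t = arm_len O e) -> tau <= t.
  by move=> t0 h; apply: first => // x; exact: (visited_all S0 Slip).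
have [w [y [pw us wt]]] := follow_tour tau0 S0 Slip ns full ff.
have [w' dw] := partial_tour_extend pw.
exists (walk_search O (w ++ w')); first exact: df_tour_search.
have [lw _ _] := dw; have us' := walk_search_unit_speed lw.
move=> t t0; rewrite ct lee_fin -wt => tw.
case: (eqVneq w [::]) => [w0|wn].
  have -> : t = 0.
    by apply/eqP; rewrite eq_le t0 andbT; move: tw; rewrite w0 /walk_len big_nil.
  by rewrite S0 (walk_search0 lw).
have [|w1 [l [w2 [s [E sl ts]]]]] := walk_search_split wn (t := t).
  by rewrite t0.
rewrite ts /walk_len (us _ _ _ E)// (us' w1 l (w2 ++ w'))//.
by rewrite E -catA.
Qed.

End Optimality.

(** * The best root *)

Section MeanDistance.
Local Open Scope classical_set_scope.
Context {R : realType} (Q : tree_network R).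
Implicit Types (a b : arc Q) (v : node Q) (x y z p q : tree_point Q).

Let md x : R := fine (mean_dist x).

Let mdE x : mean_dist x = (md x)%:E.
Proof. by rewrite /md fineK// mean_dist_fin. Qed.

(** A convexity inequality between distances that is strict inside some arc
    remains strict after averaging. *)
Lemma mean_dist_lt x p q (alpha beta : R) a : 0 < alpha -> 0 < beta ->
  (forall z, (alpha + beta) * dist x z <= beta * dist p z + alpha * dist q z) ->
  (forall z, 0 < coord a z < len a ->
     (alpha + beta) * dist x z < beta * dist p z + alpha * dist q z) ->
  (alpha + beta) * md x < beta * md p + alpha * md q.
Proof.
move=> a0 b0 le_ lt_; rewrite ltNge; apply/negP => h.
have mdist k x' : measurable_fun setT (fun z => (k * dist x' z)%:E).
  rewrite (_ : (fun _ => _) = (fun z => k%:E * (dist x' z)%:E)%E).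
    by apply: measurable_funeM; exact: measurable_dist.
  by apply/funext => z; rewrite EFinM.
have int k x' : 0 <= k ->
    (\int[uniform_law Q]_z (k * dist x' z)%:E = (k * md x')%:E)%E.
  move=> k0; rewrite EFinM -mdE -ge0_integralZl_EFin//.
  - by move=> z _; rewrite lee_fin dist_ge0.
  - exact: measurable_dist.
have [N [mN N0 hN]] : {ae uniform_law Q, forall z,
    (beta * dist p z)%:E + (alpha * dist q z)%:E = ((alpha + beta) * dist x z)%:E}%E.
  apply: ae_eq_of_le_integral => //.
  - by apply: emeasurable_funD; exact: mdist.
  - move=> z; rewrite -EFinD !lee_fin le_ andbT mulr_ge0 ?dist_ge0//; lra.
  - by rewrite int ?ltry//; lra.
  rewrite ge0_integralD//.
  - by rewrite !int ?(ltW a0) ?(ltW b0)// -?EFinD ?lee_fin//; lra.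
  - by move=> z _; rewrite lee_fin mulr_ge0 ?dist_ge0// ltW.
  - by move=> z _; rewrite lee_fin mulr_ge0 ?dist_ge0// ltW.
have : length_measure N = 0%E.
  have : uniform_law Q N = 0%E by [].
  rewrite uniform_lawE => /eqP; rewrite mule_eq0 eqe invr_eq0 gt_eqF ?total_length_gt0//=.
  by move=> /eqP.
apply/eqP; rewrite gt_eqF// /length_measure (bigD1 a)//=.
apply: (@lt_le_trans _ _ (arc_measure a N)); last first.
  by rewrite leeDl// sume_ge0// => b _; exact: measure_ge0.
rewrite /arc_measure /pushforward /mrestr (_ : _ `&` _ = `]0, len a[).
  by rewrite lebesgue_measure_itv/= lte_fin len_gt0 sube0 lte_fin len_gt0.
apply/seteqP; split=> c; first by case.
move=> cl; split=> //; apply: hN => /= E.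
move: cl; rewrite /= in_itv /= => /andP[c0 cl].
have /lt_ : 0 < coord a (arc_point a c) < len a.
  by rewrite coord_arc_point ?eqxx ?c0// (ltW c0) (ltW cl).
by move: E => -[->]; rewrite ltxx.
Qed.

(** The distance to a given point is convex along an arc, strictly so if that
    point is inside the arc. *)
Lemma interior_mean_dist a x : 0 < coord a x < len a ->
  len a * md x < (len a - coord a x) * md (Node (asrc a)) +
    coord a x * md (Node (atgt a)).
Proof.
move=> /andP[]; set s := coord a x => s0 sl.
have xE : x = arc_point a s by rewrite /s coordK// -/s s0.
have [sb sb'] : s + (len a - s) = len a /\ 0 <= s <= len a.
  by split; [lra|rewrite (ltW s0) (ltW sl)].
have diff z : (len a - s) * dist (Node (asrc a)) z + s * dist (Node (atgt a)) z
    - len a * dist x z = (len a - s) * `|0 - coord a z| + s * `|len a - coord a z|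
    - len a * `|s - coord a z|.
  rewrite !distE (bigD1 a)//= [in X in _ + s * X](bigD1 a)//= [in X in _ - _ * X](bigD1 a)//=.
  rewrite node_coord_src node_coord_tgt -/s.
  have -> : \sum_(i | i != a) `|node_coord i (atgt a) - coord i z| =
      \sum_(i | i != a) `|node_coord i (asrc a) - coord i z|.
    by apply: eq_bigr => b ba; rewrite node_coord_arc// eq_sym.
  have -> : \sum_(i | i != a) `|coord i x - coord i z| =
      \sum_(i | i != a) `|node_coord i (asrc a) - coord i z|.
    by apply: eq_bigr => b ba; rewrite xE coord_arc_point// eq_sym (negPf ba).
  by move: (\sum_(_ | _) _) => K; ring.
rewrite -[X in X * md x]sb; apply: (mean_dist_lt (a := a)) => //.
- by rewrite subr_gt0.
- move=> z; rewrite sb -subr_ge0 diff.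
  have /andP[c0 cl] := coord_bounds a z; move: (coord a z) c0 cl => c c0 cl.
  rewrite sub0r normrN (ger0_norm c0) (@ger0_norm _ (len a - c)) ?subr_ge0//.
  by case: (lerP s c) => sc; nra.
move=> z /andP[c0 cl]; rewrite sb -subr_gt0 diff; move: (coord a z) c0 cl => c c0 cl.
rewrite sub0r normrN (gtr0_norm c0) (@gtr0_norm _ (len a - c)) ?subr_gt0//.
by case: (lerP s c) => sc; nra.
Qed.

Definition other_end a v := if asrc a == v then atgt a else asrc a.

Lemma coord_other_end a v z : incident a v ->
  `|node_coord a (other_end a v) - coord a z| = len a - `|node_coord a v - coord a z|.
Proof.
have /andP[c0 cl] := coord_bounds a z.
rewrite /incident /other_end; case: eqP => [<- _|_ /= /eqP <-];
  rewrite node_coord_src node_coord_tgt sub0r normrN (ger0_norm c0) ger0_norm ?subr_ge0//.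
lra.
Qed.

Lemma coord_other_end_neq a b v : incident a v -> b != a ->
  node_coord b (other_end a v) = node_coord b v.
Proof.
rewrite /incident /other_end => inc ba; case: eqP inc => [<- _|_ /= /eqP <-].
  by rewrite node_coord_arc// eq_sym.
by rewrite node_coord_arc// eq_sym.
Qed.

Lemma incident_coord a b v : incident b v -> a != b ->
  node_coord a (asrc b) = node_coord a v.
Proof.
by move=> /orP[/eqP <- //|/eqP <-] ab; rewrite node_coord_arc// eq_sym.
Qed.

(** The node [v] is between the other ends of [a] and [b]: the distance to a
    given point is convex along this path, strictly so for points inside [a]. *)
Lemma branching_mean_dist a b v : a != b -> incident a v -> incident b v ->
  (len a + len b) * md (Node v) < len b * md (Node (other_end a v)) +
    len a * md (Node (other_end b v)).
Proof.
move=> ab av bv; have la := len_gt0 a; have lb := len_gt0 b.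
pose A z := `|node_coord a v - coord a z|; pose B z := `|node_coord b v - coord b z|.
have diff z : len b * dist (Node (other_end a v)) z + len a * dist (Node (other_end b v)) z
    - (len a + len b) * dist (Node v) z =
    2 * (len a * len b - len b * A z - len a * B z).
  have split2 p : dist p z = \sum_(c | (c != a) && (c != b)) `|coord c p - coord c z|
      + `|coord a p - coord a z| + `|coord b p - coord b z|.
    by rewrite distE (bigD1 a)//= (bigD1 b) ?(eq_sym b)//=; lra.
  rewrite !split2 /= !coord_other_end// -/(A z) -/(B z).
  rewrite (coord_other_end_neq bv ab) -/(A z) (coord_other_end_neq av) 1?eq_sym// -/(B z).
  have sumE u : incident u v -> (u == a) || (u == b) ->
      \sum_(c | (c != a) && (c != b)) `|node_coord c (other_end u v) - coord c z| =
      \sum_(c | (c != a) && (c != b)) `|node_coord c v - coord c z|.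
    move=> uv ue; apply: eq_bigr => c /andP[ca cb]; rewrite coord_other_end_neq//.
    by case/orP: ue => /eqP ->.
  rewrite !sumE ?eqxx ?orbT//; move: (\sum_(_ | _) _) => K; ring.
have AB z : A z = 0 \/ B z = 0.
  have [h|h] := coord_cross z ab; [left|right].
    by rewrite /A h (incident_coord bv ab) subrr normr0.
  by rewrite /B h (incident_coord av) 1?eq_sym// subrr normr0.
have bound c u z : `|node_coord c u - coord c z| <= len c.
  have /andP[h1 h2] := coord_bounds c z; have /andP[h3 h4] := node_coord_bounds c u.
  by rewrite ler_norml; apply/andP; split; lra.
apply: (mean_dist_lt (a := a)) => //.
  move=> z; rewrite -subr_ge0 diff; have := bound a v z; have := bound b v z.
  rewrite -/(A z) -/(B z); case: (AB z) => ->; nra.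
move=> z /andP[z0 zl]; rewrite -subr_gt0 diff.
have A1 : 0 < A z < len a.
  rewrite /A; case: (node_coord_cases a v) => ->.
    by rewrite sub0r normrN gtr0_norm ?z0.
  by rewrite gtr0_norm ?subr_gt0// zl /=; lra.
case: (AB z) A1 => ->; first by rewrite ltxx.
by move=> /andP[_ A1]; nra.
Qed.

Lemma incident_exists v : exists a, incident a v.
Proof.
case: (pickP (fun a => incident a v)) => [a h|none]; first by exists a.
case/card_gt0P: (arc_nonempty Q) => a0 _.
have vO : Node v != Node (asrc a0).
  by apply/eqP => -[h]; have := none a0; rewrite /incident h eqxx.
have [e [l0]] := arm_to_node vO; rewrite -leg_end_out /leg_end /out /=.
exists e.1; move: b; rewrite /incident; case: (e.2).
  by rewrite arc_point_len => -[->]; rewrite eqxx orbT.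
by rewrite arc_point0 => -[->]; rewrite eqxx.
Qed.

Lemma nonleaf_mean_dist v : ~ leaf_node v -> exists v', md (Node v) < md (Node v').
Proof.
move=> nl; have /card_gt1P[a [b [av bv ab]]] : (1 < degree v)%N.
  rewrite ltn_neqAle eq_sym; apply/andP; split; first exact/eqP.
  by have [a av] := incident_exists v; apply/card_gt0P; exists a; rewrite inE.
rewrite !inE in av bv; have h := branching_mean_dist ab av bv.
have la := len_gt0 a; have lb := len_gt0 b.
case: (ltP (md (Node v)) (md (Node (other_end a v)))) => h1; first by eexists; exact: h1.
case: (ltP (md (Node v)) (md (Node (other_end b v)))) => h2; first by eexists; exact: h2.
exfalso; nra.
Qed.

Lemma interior_lt_node x : (forall v, x <> Node v) -> exists v, md x < md (Node v).
Proof.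
case: x => [v /(_ v) //|p _]; set x : tree_point Q := inr p.
have xa : 0 < coord (val p).1 x < len (val p).1 by rewrite /= eqxx; exact: (valP p).
have := interior_mean_dist xa; move: xa; move: (coord _ x) => s /andP[s0 sl] h.
case: (ltP (md x) (md (Node (asrc (val p).1)))) => h1; first by eexists; exact: h1.
case: (ltP (md x) (md (Node (atgt (val p).1)))) => h2; first by eexists; exact: h2.
exfalso; nra.
Qed.

Lemma mean_dist_max x : (forall y, (mean_dist y <= mean_dist x)%E) <->
  (exists v, [/\ x = Node v, leaf_node v
    & forall v', leaf_node v' -> (mean_dist (Node v') <= mean_dist (Node v))%E]).
Proof.
split=> [h|[v [-> lv hv]] y].
  have [v xv] : exists v, x = Node v.
    apply: contrapT => nx; have [v|v] := @interior_lt_node x.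
      by move=> xv; apply: nx; exists v.
    by have := h (Node v); rewrite !mdE lee_fin leNgt => /negP.
  subst x; exists v; split=> //; apply: contrapT => /nonleaf_mean_dist[v'].
  by have := h (Node v'); rewrite !mdE lee_fin leNgt => /negP.
have [v0 max0] : exists v0, forall v', md (Node v') <= md (Node v0).
  by case: (@arg_maxP _ _ _ v predT (fun u => md (Node u)) isT) => v0 _ h;
     exists v0 => v'; exact: h.
have l0 : leaf_node v0.
  by apply: contrapT => /nonleaf_mean_dist[v']; rewrite ltNge max0.
have v0v : md (Node v0) <= md (Node v) by rewrite -lee_fin -!mdE hv.
rewrite !mdE lee_fin; apply: le_trans v0v.
case: y => [u|p]; first exact: max0.
have [//|v'] := @interior_lt_node (inr p).
by move=> /ltW h; apply: le_trans h (max0 v').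
Qed.

End MeanDistance.

Theorem corollary3 (R : realType) (Q : tree_network R) :
  (forall O : tree_point Q,
    [/\ exists S : R -> tree_point Q, optimal O (uniform_law Q) S,
        strongly_simply_searchable O (uniform_law Q)
      & min_time O (uniform_law Q) = ((total_length Q)%:E - mean_dist O)%E])
  /\
  (forall S : tree_point Q -> R -> tree_point Q,
    (forall O : tree_point Q, depth_first O (S O)) ->
    forall x : tree_point Q,
      (forall O : tree_point Q,
        (expected_time (S x) (uniform_law Q) <=
         expected_time (S O) (uniform_law Q))%E)
      <->
      (exists v : node Q,
        [/\ x = Node v,
            leaf_node v
          & forall v' : node Q, leaf_node v' ->
              (mean_dist (Node v') <= mean_dist (Node v))%E])).
Proof.
split.
  move=> O; split; first by have [S /depth_first_optimal] := depth_first_exists O; exists S.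
    exact: uniform_strongly_simply_searchable.
  exact: min_timeE.
move=> S dS x.
have timeE y : expected_time (S y) (uniform_law Q) =
    ((total_length Q)%:E - mean_dist y)%E.
  exact: depth_first_expected_time.
have leE y : ((total_length Q)%:E - mean_dist x <=
    (total_length Q)%:E - mean_dist y)%E = (mean_dist y <= mean_dist x)%E.
  by rewrite -(fineK (mean_dist_fin x)) -(fineK (mean_dist_fin y)) !lee_fin lerD2l lerN2.
rewrite -mean_dist_max; split=> h O; have := h O; by rewrite !timeE leE.
Qed.
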